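(* Let $A$ be a positive self-adjoint operator on $L^2(X,\mu)$, where $(X,\mu)$ is a measure space, such that $F(\lambda)=\|\Pi_\lambda\|_{1,\infty}$ is finite for all $\lambda>0$, where $\Pi_\lambda=\chi_A(]0,\lambda])$. Let $f$ be a non-zero element of $V=L^2(X)\cap(\ker A)^\perp$ with $f\in L^1(X)$, and let $\mathcal{E}(f)=\langle Af,f\rangle_2$. (1) It holds that $$\int_X |f(x)|^2\,F^{-1}\Bigl(\frac{|f(x)|}{2\|f\|_1}\Bigr)\,d\mu(x)\le 4\,\mathcal{E}(f).$$ (2) If $\varphi:[0,\infty[\to\mathbb{R}$ is a convex function such that $0\le\varphi(y)\le y\,F^{-1}(y)$ for all $y\ge 0$, then $$\|f\|_1^2\;\varphi\Bigl(\frac{\|f\|_2^2}{2\|f\|_1^2}\Bigr)\le 2\,\mathcal{E}(f).$$ (3) In particular, for $\varphi$ as in (2), if $f$ and $Af$ are supported in a domain (measurable subset) $\Omega\subset X$ of finite measure, then $$\mu(\Omega)\,\varphi\Bigl(\frac{1}{2\mu(\Omega)}\Bigr)\le\frac{2\,\mathcal{E}(f)}{\|f\|_2^2}.$$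
   Context: ''Positive'' means $\langle Af,f\rangle\ge 0$; $A$ may be unbounded and may have a kernel. The energy is $\mathcal{E}(f)=\|A^{1/2}f\|_2^2$ ($=+\infty$ if $f$ is not in the domain of $A^{1/2}$). For a bounded operator $P$ on $L^2(X)$, $\|P\|_{1,\infty}=\sup\{\|Pf\|_\infty : f\in L^1\cap L^2,\ \|f\|_1\le 1\}\in[0,+\infty]$ is its norm as an operator from $L^1$ to $L^\infty$. $F$ is non-decreasing and right continuous on $]0,\infty[$, $F(0)=0$, and $F^{-1}$ denotes its right continuous inverse $F^{-1}(y)=\sup\{\lambda\ge 0 : F(\lambda)\le y\}\in[0,+\infty]$, with $0\cdot\infty=0$. *)

(* Defs.v *)
From HB Require Import structures.
From mathcomp Require Import all_boot all_order all_algebra.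
From mathcomp Require Import all_classical all_reals all_analysis.
From mathcomp Require Export complex.

Set Implicit Arguments.
Unset Strict Implicit.
Unset Printing Implicit Defensive.

Import Order.TTheory GRing.Theory Num.Theory.
Import numFieldNormedType.Exports.

Local Open Scope classical_set_scope.
Local Open Scope ring_scope.
Local Open Scope complex_scope.

Section ComplexLp.
Context {d : measure_display} {T : measurableType d} {R : realType}.
Variable mu : {measure set T -> \bar R}.
Implicit Types (f g : T -> R[i]) (p : \bar R).

Definition cmod f (x : T) : R := ComplexField.Normc.normc (f x).

Definition cmeasurable f :=
  measurable_fun setT (fun x => complex.Re (f x)) /\
  measurable_fun setT (fun x => complex.Im (f x)).

Definition cLnorm p f : \bar R := Lnorm mu p (EFin \o cmod f).

(* The elements of L^p are functions, compared with [_ = _ %[ae mu]]; no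
   quotient is taken. *)
Definition cL p : set (T -> R[i]) :=
  [set f | cmeasurable f /\ (cLnorm p f < +oo)%E].

Definition cintegral f : R[i] :=
  Rintegral mu setT (fun x => complex.Re (f x)) +i*
  Rintegral mu setT (fun x => complex.Im (f x)).

Definition inner f g : R[i] := cintegral (fun x => f x * (g x)^*).

End ComplexLp.

Notation cL1 mu := (cL mu 1%E).
Notation cL2 mu := (cL mu 2%:E).

(* A possibly unbounded operator on L^2: the values of [app] off [dom] are
   irrelevant. *)
Record operator (T : Type) (R : realType) := Operator {
  dom : set (T -> R[i]) ;
  app :> (T -> R[i]) -> T -> R[i] }.

Section Operators.
Context {d : measure_display} {T : measurableType d} {R : realType}.
Variable mu : {measure set T -> \bar R}.
Implicit Types (A P : operator T R) (f g h : T -> R[i]).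

(* The third clause makes A act on classes modulo equality a.e. *)
Definition linear_operator A :=
  [/\ dom A `<=` cL2 mu,
      (forall f, dom A f -> cL2 mu (A f)),
      (forall f g, dom A f -> cL2 mu g -> f = g %[ae mu] ->
        dom A g /\ A f = A g %[ae mu]),
      dom A (fun=> 0) &
      (forall (a : R[i]) f g, dom A f -> dom A g ->
        dom A (fun x => a * f x + g x) /\
        A (fun x => a * f x + g x) = (fun x => a * A f x + A g x) %[ae mu])].

Definition densely_defined A :=
  forall g, cL2 mu g -> forall e : R, 0 < e ->
  exists2 f, dom A f & (cLnorm mu 2%:E (fun x => g x - f x)%R < e%:E)%E.

(* (g, h) is in the graph of the adjoint of A *)
Definition adjoint_graph A g h :=
  [/\ cL2 mu g, cL2 mu h &
      forall f, dom A f -> inner mu (A f) g = inner mu f h].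

(* A = A^*, equality of domains included *)
Definition self_adjoint A :=
  [/\ linear_operator A, densely_defined A &
      forall g h, adjoint_graph A g h <->
        [/\ dom A g, cL2 mu h & h = A g %[ae mu]]].

(* the order of R[i] forces <Af, f> to be real *)
Definition positive_operator A :=
  forall f, dom A f -> 0 <= inner mu (A f) f.

Definition op_ker A : set (T -> R[i]) :=
  [set f | dom A f /\ A f = (fun=> 0) %[ae mu]].

Definition orthocomplement (K : set (T -> R[i])) : set (T -> R[i]) :=
  [set f | cL2 mu f /\ forall g, K g -> inner mu f g = 0].

Definition orthogonal_projection P :=
  [/\ linear_operator P, dom P = cL2 mu,
      (forall f, cL2 mu f -> P (P f) = P f %[ae mu]) &
      (forall f g, cL2 mu f -> cL2 mu g -> inner mu (P f) g = inner mu f (P g))].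

(* ||P||_{1,oo}, for P bounded on L^2 *)
Definition norm1oo P : \bar R :=
  ereal_sup [set cLnorm mu +oo%E (P f) |
    f in [set f | [/\ cL1 mu f, cL2 mu f & (cLnorm mu 1%E f <= 1)%E]]].

End Operators.

Section SpectralCalculus.
Context {d : measure_display} {T : measurableType d} {R : realType}.
Variable mu : {measure set T -> \bar R}.
Implicit Types (E : set R -> operator T R) (A S : operator T R).
Implicit Types (f : T -> R[i]) (B C : set R).

(* Projection-valued Borel measures on the real line; countable additivity is
   meant in the strong operator topology. *)
Record projection_valued_measure E : Prop := {
  pvm_projection : forall B, measurable B -> orthogonal_projection mu (E B) ;
  pvm_set0 : forall f, cL2 mu f -> E set0 f = (fun=> 0) %[ae mu] ;
  pvm_setT : forall f, cL2 mu f -> E setT f = f %[ae mu] ;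
  pvm_setI : forall B C, measurable B -> measurable C ->
    forall f, cL2 mu f -> E (B `&` C) f = E B (E C f) %[ae mu] ;
  pvm_sigma_additive : forall F : nat -> set R,
    (forall n, measurable (F n)) -> trivIset setT F ->
    forall f, cL2 mu f ->
    (fun n : nat => cLnorm mu 2%:E
       (fun x => E (\bigcup_k F k) f x - \sum_(i < n) E (F i) f x)%R)
      @ \oo --> 0%E }.

(* the measure d<E f, f> on the line *)
Definition spectral_dist E f : set R -> \bar R :=
  fun B => (complex.Re (inner mu (E B f) f))%:E.

(* S = phi(A) = \int phi dE: its domain is { f | \int |phi|^2 d<E f,f> < oo },
   on which <S f, f> = \int phi d<E f,f>; by polarization this determines S. *)
Definition function_of E (phi : R -> R) S :=
  [/\ linear_operator mu S,
      dom S = cL2 mu `&`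
        [set f | (\int[spectral_dist E f]_l ((phi l) ^+ 2)%:E < +oo)%E] &
      forall f, dom S f ->
        inner mu (S f) f = (fine (\int[spectral_dist E f]_l (phi l)%:E))%:C].

(* E is the spectral measure of A, i.e. A = \int l dE(l) and E(B) = chi_A(B) *)
Definition spectral_measure E A :=
  projection_valued_measure E /\ function_of E id A.

(* the energy ||S f||_2^2 with S = A^{1/2}, i.e. function_of E Num.sqrt S; Num.sqrt
   vanishes on the negative reals, which are E-null when A is positive. *)
Definition energy S f : \bar R :=
  if `[< dom S f >] then ((cLnorm mu 2%:E (S f)) ^+ 2)%E else +oo%E.

(* F(l) = ||chi_A(]0, l])||_{1,oo} *)
Definition spectral_density E (l : R) : \bar R := norm1oo mu (E `]0, l]%classic).

End SpectralCalculus.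

(* the right continuous inverse of a non-decreasing F on [0, oo[ *)
Definition rc_inverse {R : realType} (F : R -> \bar R) (y : R) : \bar R :=
  ereal_sup [set l%:E | l in [set l : R | 0 <= l /\ (F l <= y%:E)%E]].

(* Main.v *)
(** For [l > 0] split [f] into [E(]0,l]) f] and the rest: since [f] is orthogonal
    to the kernel of [A], the rest has squared norm [<E(]l,oo[) f, f>], while
    [|E(]0,l]) f| <= F(l) ||f||_1] almost everywhere.  Hence, where
    [F(l) <= |f| / (2 ||f||_1)], the rest is at least [|f| / 2], so that
<<
      \int |f|^2 1(F(l) <= |f| / (2 ||f||_1)) dmu <= 4 <E(]l,oo[) f, f>.
>>
    Integrating over [l] gives (1), as [F^{-1}(y)] is the length of
    [{ l > 0 : F(l) <= y }] and [\int <E(]l,oo[) f, f> dl] is the energy.  To avoid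
    a Fubini argument on a non-sigma-finite space, both integrals over [l] are
    replaced by Riemann sums, and Fatou's lemma passes to the limit.  Then (2) is
    Jensen's inequality for the probability measure [|f| dmu / ||f||_1], and (3)
    follows from Cauchy-Schwarz since [phi y / y] is non-decreasing. *)
Require Import Defs.
From HB Require Import structures.
From mathcomp Require Import all_boot all_order all_algebra.
From mathcomp Require Import all_classical all_reals all_analysis.
From mathcomp Require Import complex.
From mathcomp Require Import measurable_realfun ess_sup_inf.
From mathcomp Require Import ring lra.

Set Implicit Arguments.
Unset Strict Implicit.
Unset Printing Implicit Defensive.

Import Order.TTheory GRing.Theory Num.Theory.
Import numFieldNormedType.Exports.

Local Open Scope classical_set_scope.
Local Open Scope ring_scope.

(** * The Hilbert space of complex square-integrable functions *)
Section ComplexL2.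
Local Open Scope complex_scope.
Context {d : measure_display} {T : measurableType d} {R : realType}.
Variable mu : {measure set T -> \bar R}.
Implicit Types (f g h u v : T -> R[i]) (a b : R[i]).

(** The length formula for [F^{-1}] requires [F] to be non-decreasing, which is not formal:
    [E(]0,l]) = E(]0,l]) E(]0,m])] for [l <= m], but neither factor need be bounded on [L^1] or on
    [L^oo]. The way out is that, for an orthogonal projection [P], [||P||_{1,oo}] controls
    [||P g||_2^2 = <P g, g>] by [||g||_1^2], and that Hilbert norms are monotone in the spectral
    set. A second obstacle is that [function_of] fixes an operator by its domain and its quadratic
    form only. Norms such as [||S f||] are therefore reached by polarization on spectral pieces, and
    only from below: for [S = A^{1/2}] and [B] inside [[r,oo[] with [r >= 0],
    [r ||E(B) f||^2 <= ||E(B) S f||^2]. These bounds are then summed by parts. Finally, that [E]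
    vanishes on the negative half-line and that [E({0})] maps into the kernel of [A] has to be
    derived, from positivity and from [A = A^*]. *)

Lemma cReM a b : complex.Re (a * b) =
  complex.Re a * complex.Re b - complex.Im a * complex.Im b.
Proof. by case: a b => [? ?] []. Qed.

Lemma cImM a b : complex.Im (a * b) =
  complex.Re a * complex.Im b + complex.Im a * complex.Re b.
Proof. by case: a b => [? ?] []. Qed.

Lemma cReD a b : complex.Re (a + b) = complex.Re a + complex.Re b.
Proof. by case: a b => [? ?] []. Qed.

Lemma cImD a b : complex.Im (a + b) = complex.Im a + complex.Im b.
Proof. by case: a b => [? ?] []. Qed.

Lemma cReJ a : complex.Re a^* = complex.Re a.
Proof. by case: a. Qed.

Lemma cImJ a : complex.Im a^* = - complex.Im a.
Proof. by case: a. Qed.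

Lemma cReN a : complex.Re (- a) = - complex.Re a.
Proof. by case: a. Qed.

Lemma cImN a : complex.Im (- a) = - complex.Im a.
Proof. by case: a. Qed.

Definition ReImE := (cReM, cImM, cReD, cImD, cReJ, cImJ, cReN, cImN).

Lemma complex_eqP a b :
  complex.Re a = complex.Re b -> complex.Im a = complex.Im b -> a = b.
Proof. by case: a b => [? ?] [? ?] /= -> ->. Qed.

Lemma cmod_sqr f x :
  cmod f x ^+ 2 = complex.Re (f x) ^+ 2 + complex.Im (f x) ^+ 2.
Proof.
rewrite /cmod; case: (f x) => a b /=.
by rewrite sqr_sqrtr// addr_ge0// sqr_ge0.
Qed.

Lemma cmod_ge0 f x : 0 <= cmod f x.
Proof. by rewrite /cmod; case: (f x) => a b /=; rewrite sqrtr_ge0. Qed.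

Lemma cmod_eq0 f x : cmod f x = 0 -> f x = 0.
Proof. exact: ComplexField.Normc.eq0_normc. Qed.

Lemma measurable_cmod f : cmeasurable f -> measurable_fun setT (cmod f).
Proof.
move=> [mRe mIm]; have -> : cmod f = Num.sqrt \o
    (fun x => complex.Re (f x) ^+ 2 + complex.Im (f x) ^+ 2).
  by apply/funext => x; rewrite /cmod /=; case: (f x).
apply: measurableT_comp.
  exact: (continuous_measurable_fun (@sqrt_continuous R)).
by apply: measurable_funD; exact: measurable_funX.
Qed.

Lemma cmeasurable_lin a f g : cmeasurable f -> cmeasurable g ->
  cmeasurable (fun x => a * f x + g x).
Proof.
move=> [f1 f2] [g1 g2]; split.
- under eq_fun do rewrite cReD cReM.
  by apply: measurable_funD => //; apply: measurable_funB => //;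
    apply: measurable_funM.
- under eq_fun do rewrite cImD cImM.
  by apply: measurable_funD => //; apply: measurable_funD => //;
    apply: measurable_funM.
Qed.

Lemma cmeasurable_mulJ f g : cmeasurable f -> cmeasurable g ->
  cmeasurable (fun x => f x * (g x)^*).
Proof.
move=> [f1 f2] [g1 g2]; split.
- under eq_fun do rewrite !ReImE mulrN opprK.
  by apply: measurable_funD => //; apply: measurable_funM.
- under eq_fun do rewrite !ReImE.
  by apply: measurable_funD => //; apply: measurable_funM => //;
   exact: measurable_funN.
Qed.

Lemma cLnorm2E f :
  cLnorm mu 2%:E f = ((\int[mu]_x (cmod f x ^+ 2)%:E) `^ 2^-1)%E.
Proof.
rewrite /cLnorm unlock; congr (_ `^ _)%E; apply: eq_integral => x _ /=.
by rewrite ger0_norm ?cmod_ge0// powR_mulrn ?cmod_ge0.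
Qed.

Lemma cL2P f : cL2 mu f <->
  cmeasurable f /\ mu.-integrable setT (fun x => (cmod f x ^+ 2)%:E).
Proof.
have s0 x : (0 <= (cmod f x ^+ 2)%:E)%E by rewrite lee_fin sqr_ge0.
have abs_int : (\int[mu]_x `|(cmod f x ^+ 2)%:E| =
                \int[mu]_x (cmod f x ^+ 2)%:E)%E.
  by apply: eq_integral => x _; rewrite gee0_abs.
split=> [[mf lf]|[mf /integrableP[_]]].
- split=> //; apply/integrableP; split.
    by apply/measurable_EFinP; apply: measurable_funX; exact: measurable_cmod.
  rewrite abs_int; move: lf; rewrite cLnorm2E => lf; rewrite ltey.
  by apply/eqP => iy; move: lf; rewrite iy poweRyr ?ltxx// invr_neq0.
- rewrite abs_int => lf; split => //; rewrite cLnorm2E.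
  by apply: poweR_lty.
Qed.

Definition cintegrable f :=
  mu.-integrable setT (EFin \o (fun x => complex.Re (f x))) /\
  mu.-integrable setT (EFin \o (fun x => complex.Im (f x))).

Lemma cintegral_lin a f g : cintegrable f -> cintegrable g ->
  cintegral mu (fun x => a * f x + g x) = a * cintegral mu f + cintegral mu g.
Proof.
move=> [fr fi] [gr gi].
have Z (k : R) (k' : T -> R) : mu.-integrable setT (EFin \o k') ->
    mu.-integrable setT (EFin \o (fun x => k * k' x)).
  by move=> ik; have := integrableZl measurableT k ik.
have D (k k' : T -> R) : mu.-integrable setT (EFin \o k) ->
    mu.-integrable setT (EFin \o k') ->
    mu.-integrable setT (EFin \o (fun x => k x + k' x)).
  by move=> ik ik'; have := integrableD measurableT ik ik'.
have DR k k' : mu.-integrable setT (EFin \o k) ->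
    mu.-integrable setT (EFin \o k') ->
    Rintegral mu setT (fun x => k x + k' x) =
    Rintegral mu setT k + Rintegral mu setT k'.
  by move=> ik ik'; rewrite RintegralD.
apply: complex_eqP.
- rewrite cReD cReM /cintegral /=.
  under eq_Rintegral do rewrite cReD cReM -mulNr.
  by rewrite !DR ?RintegralZl ?mulNr//; [exact: Z|exact: Z|apply: D; exact: Z].
- rewrite cImD cImM /cintegral /=.
  under eq_Rintegral do rewrite cImD cImM.
  by rewrite !DR ?RintegralZl//; [exact: Z|exact: Z|apply: D; exact: Z].
Qed.

(** Both parts of [f x * (g x)^*] are bounded by [|f x|^2 + |g x|^2]; the squares fed to [nra] are
    the needed instances of [2 |r s| <= r^2 + s^2]. *)
Lemma cL2_cintegrable_mulJ f g : cL2 mu f -> cL2 mu g ->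
  cintegrable (fun x => f x * (g x)^*).
Proof.
move=> /cL2P[mf lf] /cL2P[mg lg].
have [mr mi] := cmeasurable_mulJ mf mg.
have lfg := integrableD measurableT lf lg.
split; (apply: le_integrable lfg => //; [exact/measurable_EFinP|]);
  move=> x _ /=; rewrite lee_fin [X in _ <= X]ger0_norm ?addr_ge0 ?sqr_ge0//;
  rewrite !cmod_sqr !ReImE ler_norml;
  move: (f x) (g x) => [a b] [c e] /=;
  have := sqr_ge0 (a + c); have := sqr_ge0 (b + e);
  have := sqr_ge0 (a - c); have := sqr_ge0 (b - e);
  have := sqr_ge0 (a + e); have := sqr_ge0 (b + c);
  have := sqr_ge0 (a - e); have := sqr_ge0 (b - c);
  by move=> *; apply/andP; split; nra.
Qed.

Lemma cL2_lin a f g : cL2 mu f -> cL2 mu g ->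
  cL2 mu (fun x => a * f x + g x).
Proof.
move=> /cL2P[mf lf] /cL2P[mg lg].
apply/cL2P; split; first exact: cmeasurable_lin.
(* From [|a f + g|^2 <= 2 |a|^2 |f|^2 + 2 |g|^2]. *)
set k := 2 * (complex.Re a ^+ 2 + complex.Im a ^+ 2).
have := integrableD measurableT (integrableZl measurableT k lf)
  (integrableZl measurableT 2 lg).
apply: le_integrable => //.
  apply/measurable_EFinP; apply: measurable_funX; apply: measurable_cmod.
  exact: cmeasurable_lin.
move=> x _ /=; rewrite lee_fin ger0_norm ?sqr_ge0// ger0_norm; last first.
  by rewrite addr_ge0// mulr_ge0 ?sqr_ge0// mulr_ge0// addr_ge0 ?sqr_ge0.
rewrite !cmod_sqr !ReImE {}/k; move: a (f x) (g x) => [a b] [r s] [t w] /=.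
have := sqr_ge0 ((a * r - b * s) - t); have := sqr_ge0 ((a * s + b * r) - w).
nra.
Qed.

Lemma cL2_0 : cL2 mu (fun=> 0).
Proof.
apply/cL2P; split; first by split; exact: measurable_cst.
apply: (eq_integrable measurableT (cst 0%E)) => [x _|]; last exact: integrable0.
by rewrite cmod_sqr /= expr0n addr0.
Qed.

Lemma cL2Z a f : cL2 mu f -> cL2 mu (fun x => a * f x).
Proof.
move=> f2; have := cL2_lin a f2 cL2_0.
by under eq_fun do rewrite addr0.
Qed.

Lemma cL2D f g : cL2 mu f -> cL2 mu g -> cL2 mu (fun x => f x + g x).
Proof.
move=> f2 g2; have := cL2_lin 1 f2 g2.
by under eq_fun do rewrite mul1r.
Qed.

Lemma cL2B f g : cL2 mu f -> cL2 mu g -> cL2 mu (fun x => f x - g x).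
Proof.
move=> f2 g2; have := cL2_lin (-1) g2 f2.
by under eq_fun do rewrite mulN1r addrC.
Qed.

Lemma inner_linl a f g h : cL2 mu f -> cL2 mu g -> cL2 mu h ->
  inner mu (fun x => a * f x + g x) h = a * inner mu f h + inner mu g h.
Proof.
move=> f2 g2 h2; rewrite /inner.
under eq_fun do rewrite mulrDl -mulrA.
by apply: cintegral_lin; exact: cL2_cintegrable_mulJ.
Qed.

Lemma innerJ f g : cL2 mu f -> cL2 mu g -> inner mu g f = (inner mu f g)^*.
Proof.
move=> f2 g2; have [ir ii] := cL2_cintegrable_mulJ f2 g2.
apply: complex_eqP; rewrite ?cReJ ?cImJ /=.
- by apply: eq_Rintegral => x _; rewrite !ReImE; ring.
- rewrite -[RHS]mulN1r -RintegralZl//; apply: eq_Rintegral => x _.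
  by rewrite !ReImE; ring.
Qed.

Lemma inner_linr a f g h : cL2 mu f -> cL2 mu g -> cL2 mu h ->
  inner mu h (fun x => a * f x + g x) = a^* * inner mu h f + inner mu h g.
Proof.
move=> f2 g2 h2.
rewrite (@innerJ (fun x => a * f x + g x)) ?inner_linl//; last exact: cL2_lin.
rewrite (innerJ f2 h2) (innerJ g2 h2).
by apply: complex_eqP; rewrite !ReImE; ring.
Qed.

Lemma inner0l g : inner mu (fun=> 0) g = 0.
Proof.
rewrite /inner; under eq_fun do rewrite mul0r.
rewrite /cintegral /=; congr (_ +i* _);
by rewrite /Rintegral integral0.
Qed.

Lemma inner_ae f f' g g' : cmeasurable f -> cmeasurable f' -> cmeasurable g ->
  cmeasurable g' -> f = f' %[ae mu] -> g = g' %[ae mu] ->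
  inner mu f g = inner mu f' g'.
Proof.
move=> mf mf' mg mg' ff' gg'.
have [mr mi] := cmeasurable_mulJ mf mg.
have [mr' mi'] := cmeasurable_mulJ mf' mg'.
by congr (_ +i* _); congr fine; apply: ae_eq_integral => //;
  try exact/measurable_EFinP; apply: filterS2 ff' gg' => x /(_ I) /= -> /(_ I) ->.
Qed.

Definition sqnorm f : R := complex.Re (inner mu f f).

Lemma sqnormE f : sqnorm f = fine (\int[mu]_x (cmod f x ^+ 2)%:E)%E.
Proof.
congr fine; apply: eq_integral => x _.
by congr EFin; rewrite cmod_sqr !ReImE; ring.
Qed.

Lemma sqnorm_ge0 f : 0 <= sqnorm f.
Proof.
rewrite sqnormE fine_ge0// integral_ge0// => x _.
by rewrite lee_fin sqr_ge0.
Qed.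

Lemma inner_self f : inner mu f f = (sqnorm f)%:C.
Proof.
congr (_ +i* _); rewrite /Rintegral integral0_eq// => x _.
by congr EFin; rewrite !ReImE; ring.
Qed.

Lemma integral_cmod2 f : cL2 mu f ->
  (\int[mu]_x (cmod f x ^+ 2)%:E = (sqnorm f)%:E)%E.
Proof.
move=> /cL2P[_ lf].
by rewrite sqnormE fineK// integrable_fin_num.
Qed.

Lemma cLnorm2_sqnorm f : cL2 mu f ->
  cLnorm mu 2%:E f = (Num.sqrt (sqnorm f))%:E.
Proof.
move=> f2; rewrite cLnorm2E integral_cmod2// poweR_EFin.
by rewrite powR12_sqrt ?sqnorm_ge0.
Qed.

Lemma cLnorm2_sqr f : cL2 mu f -> (cLnorm mu 2%:E f ^+ 2 = (sqnorm f)%:E)%E.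
Proof.
move=> f2; rewrite cLnorm2_sqnorm// -EFin_expe.
by rewrite sqr_sqrtr ?sqnorm_ge0.
Qed.

Lemma sqnorm_eq0 f : cL2 mu f -> sqnorm f = 0 -> f = (fun=> 0) %[ae mu].
Proof.
move=> f2 f0; have [mf _] := f2.
have m : measurable_fun setT (EFin \o cmod f).
  by apply/measurable_EFinP; exact: measurable_cmod.
have : cLnorm mu 2%:E f = 0%E by rewrite cLnorm2_sqnorm// f0 sqrtr0.
move=> /(Lnorm_eq0_eq0 m); rewrite lte_fin ltr0n => /(_ isT).
apply: filterS => x /(_ I) /= [] fx0 _.
exact: cmod_eq0.
Qed.

(** The polynomial [||t f + g||^2] in a real [t] is nonnegative; it is evaluated at its minimum
    [t = - b / ||f||^2]. *)
Lemma cauchy_schwarz f g : cL2 mu f -> cL2 mu g ->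
  complex.Re (inner mu f g) ^+ 2 <= sqnorm f * sqnorm g.
Proof.
move=> f2 g2; move zE : (inner mu f g) => z; set b := complex.Re z.
have P t : 0 <= t ^+ 2 * sqnorm f + 2 * t * b + sqnorm g.
  have := sqnorm_ge0 (fun x => t%:C * f x + g x).
  rewrite {1}/sqnorm inner_linl ?inner_linr//; last exact: cL2_lin.
  rewrite !inner_self (innerJ f2 g2) zE !ReImE /= -/b.
  by congr (0 <= _); ring.
have [f0|f0] := eqVneq (sqnorm f) 0.
  rewrite f0 mul0r; have [->|b0] := eqVneq b 0; first by rewrite expr0n.
  (* With [||f|| = 0] the polynomial is affine of slope [2 b]; this [t] would give it the value
     [-1]. *)
  have := P (- (sqnorm g + 1) / (2 * b)).
  rewrite f0 mulr0 add0r.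
  have -> : 2 * (- (sqnorm g + 1) / (2 * b)) * b = - (sqnorm g + 1) by field.
  by lra.
have fp : 0 < sqnorm f by rewrite lt_neqAle eq_sym f0 sqnorm_ge0.
have := P (- b / sqnorm f).
have -> : (- b / sqnorm f) ^+ 2 * sqnorm f + 2 * (- b / sqnorm f) * b + sqnorm g
  = sqnorm g - b ^+ 2 / sqnorm f by field.
by rewrite subr_ge0 ler_pdivrMr// mulrC.
Qed.

End ComplexL2.

Section IntegralSetFunction.
Import HBNNSimple.

(** The integral only sees level sets of simple functions, which are measurable. This moves
    integrals against [spectral_dist], a bare set function, to the genuine measure
    [spectral_meas]. *)
Lemma eq_integral_setfun {d} {T : measurableType d} {R : realType}
    (m1 m2 : set T -> \bar R) (D : set T) (f : T -> \bar R) :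
  (forall A, measurable A -> m1 A = m2 A) ->
  (\int[m1]_(x in D) f x = \int[m2]_(x in D) f x)%E.
Proof.
move=> m12; rewrite /integral.
have eqs (h : {nnsfun T >-> R}) : sintegral m1 h = sintegral m2 h.
  apply: eq_fsbigr => x _; congr (_ * _)%E; apply: m12.
  exact: measurable_sfunP.
by congr (_ - _)%E; congr ereal_sup; apply/seteqP; split=> _ [h hf <-];
  exists h.
Qed.

End IntegralSetFunction.

(** * Linear operators and orthogonal projections on L^2 *)

Section Operators.
Local Open Scope complex_scope.
Context {d : measure_display} {T : measurableType d} {R : realType}.
Variable mu : {measure set T -> \bar R}.
Implicit Types (A P : operator T R) (f g h u v : T -> R[i]) (a b : R[i]).

Lemma sqnorm_ae f g : cmeasurable f -> cmeasurable g -> f = g %[ae mu] ->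
  sqnorm mu f = sqnorm mu g.
Proof. by move=> mf mg fg; rewrite /sqnorm (inner_ae mf mg mf mg fg fg). Qed.

Lemma norm_Re_inner f g : cL2 mu f -> cL2 mu g ->
  `|complex.Re (inner mu f g)| <= Num.sqrt (sqnorm mu f) * Num.sqrt (sqnorm mu g).
Proof.
move=> f2 g2; rewrite -sqrtrM ?sqnorm_ge0// -sqrtr_sqr ler_wsqrtr//.
exact: cauchy_schwarz.
Qed.

Lemma cL2_sum n (F : nat -> T -> R[i]) : (forall i, cL2 mu (F i)) ->
  cL2 mu (fun x => \sum_(i < n) F i x).
Proof.
move=> F2; elim: n => [|n IH].
  by under eq_fun do rewrite big_ord0; exact: cL2_0.
by under eq_fun do rewrite big_ord_recr /=; exact: cL2D.
Qed.

Lemma innerDl f g h : cL2 mu f -> cL2 mu g -> cL2 mu h ->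
  inner mu (fun x => f x + g x) h = inner mu f h + inner mu g h.
Proof.
move=> f2 g2 h2; rewrite (_ : (fun x => f x + g x) = fun x => 1 * f x + g x).
  by rewrite inner_linl// mul1r.
by apply/funext => x; rewrite mul1r.
Qed.

Lemma innerBl f g h : cL2 mu f -> cL2 mu g -> cL2 mu h ->
  inner mu (fun x => f x - g x) h = inner mu f h - inner mu g h.
Proof.
move=> f2 g2 h2.
rewrite (_ : (fun x => f x - g x) = fun x => (-1) * g x + f x).
  by rewrite inner_linl// mulN1r addrC.
by apply/funext => x; rewrite mulN1r addrC.
Qed.

Lemma innerBr f g h : cL2 mu f -> cL2 mu g -> cL2 mu h ->
  inner mu h (fun x => f x - g x) = inner mu h f - inner mu h g.
Proof.
move=> f2 g2 h2; rewrite (innerJ (cL2B f2 g2) h2) innerBl//.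
rewrite (innerJ f2 h2) (innerJ g2 h2).
by apply: complex_eqP; rewrite !ReImE; ring.
Qed.

Lemma innerZl a f h : cL2 mu f -> cL2 mu h ->
  inner mu (fun x => a * f x) h = a * inner mu f h.
Proof.
move=> f2 h2; rewrite (_ : (fun x => a * f x) = fun x => a * f x + 0).
  by rewrite inner_linl ?inner0l ?addr0//; exact: cL2_0.
by apply/funext => x; rewrite addr0.
Qed.

Lemma sqnormZ a f : cL2 mu f ->
  sqnorm mu (fun x => a * f x) =
  (complex.Re a ^+ 2 + complex.Im a ^+ 2) * sqnorm mu f.
Proof.
move=> f2; rewrite {1}/sqnorm innerZl//; last exact: cL2Z.
rewrite innerJ ?innerZl// ?inner_self//; last exact: cL2Z.
by rewrite !ReImE /=; ring.
Qed.

Lemma inner_suml n (F : nat -> T -> R[i]) h : (forall i, cL2 mu (F i)) ->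
  cL2 mu h ->
  inner mu (fun x => \sum_(i < n) F i x) h = \sum_(i < n) inner mu (F i) h.
Proof.
move=> F2 h2; elim: n => [|n IH].
  by under eq_fun do rewrite big_ord0; rewrite big_ord0 inner0l.
under eq_fun do rewrite big_ord_recr /=.
by rewrite innerDl// ?IH ?big_ord_recr//; exact: cL2_sum.
Qed.

Section LinearOperator.
Variable A : operator T R.
Hypothesis linA : linear_operator mu A.

Lemma dom_cL2 f : dom A f -> cL2 mu f.
Proof. by case: linA => /(_ f). Qed.

Lemma app_cL2 f : dom A f -> cL2 mu (A f).
Proof. by case: linA => _ /(_ f). Qed.

Lemma dom_lin a f g : dom A f -> dom A g -> dom A (fun x => a * f x + g x).
Proof. by case: linA => _ _ _ _ H fA gA; case: (H a f g fA gA). Qed.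

Lemma app_lin a f g : dom A f -> dom A g ->
  A (fun x => a * f x + g x) = (fun x => a * A f x + A g x) %[ae mu].
Proof. by case: linA => _ _ _ _ H fA gA; case: (H a f g fA gA). Qed.

Lemma inner_app_lin a f g h : dom A f -> dom A g -> cL2 mu h ->
  inner mu (A (fun x => a * f x + g x)) h =
  a * inner mu (A f) h + inner mu (A g) h.
Proof.
move=> fA gA h2; rewrite -inner_linl//; try exact: app_cL2.
have m1 : cmeasurable (A (fun x => a * f x + g x)).
  by have [] := app_cL2 (dom_lin a fA gA).
have m2 : cmeasurable (fun x => a * A f x + A g x).
  by apply: cmeasurable_lin; [case: (app_cL2 fA)|case: (app_cL2 gA)].
have [mh _] := h2.
by apply: inner_ae => //; [exact: app_lin|exact: ae_eq_refl].
Qed.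

Lemma app_ae f g : dom A f -> cL2 mu g -> f = g %[ae mu] -> A f = A g %[ae mu].
Proof. by case: linA => _ _ H _ _ fA g2 fg; case: (H _ _ fA g2 fg). Qed.

Lemma appZ a f : dom A f -> A (fun x => a * f x) = (fun x => a * A f x) %[ae mu].
Proof.
move=> fA; have dom0 : dom A (fun=> 0) by case: linA.
have A0 : A (fun=> 0) = (fun=> 0) %[ae mu].
  (* Linearity is given for combinations [a f + g]; with [a = -1] and [f = g = 0] it yields
     [A 0 = - A 0 + A 0 = 0]. *)
  have e : (fun _ : T => -1 * 0 + 0 : R[i]) = (fun=> 0).
    by apply/funext => x; rewrite mulr0 addr0.
  have := app_lin (-1) dom0 dom0; rewrite e.
  by apply: filterS => x /(_ I) -> _; rewrite mulN1r addrC subrr.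
have e : (fun x => a * f x + 0) = (fun x => a * f x).
  by apply/funext => x; rewrite addr0.
have := app_lin a fA dom0; rewrite e.
by apply: filterS2 A0 => x /(_ I) A0x /(_ I) -> _; rewrite A0x addr0.
Qed.

End LinearOperator.

Section Projection.
Variable P : operator T R.
Hypothesis projP : orthogonal_projection mu P.

Lemma projection_lin : linear_operator mu P.
Proof. by case: projP. Qed.

Lemma projection_dom f : cL2 mu f -> dom P f.
Proof. by case: projP => _ ->. Qed.

Lemma projection_cL2 f : cL2 mu f -> cL2 mu (P f).
Proof.
by move=> f2; apply: app_cL2 (projection_dom f2); exact: projection_lin.
Qed.

Lemma projection_sym f g : cL2 mu f -> cL2 mu g ->
  inner mu (P f) g = inner mu f (P g).
Proof. by case: projP => _ _ _ /[apply] /[apply]. Qed.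

Lemma inner_projection f g : cL2 mu f -> cL2 mu g ->
  inner mu (P f) g = inner mu (P f) (P g).
Proof.
move=> f2 g2; rewrite -projection_sym//; last exact: projection_cL2.
have [_ _ idem _] := projP.
have [mg _] := g2; have [mPf _] := projection_cL2 f2.
have [mPPf _] := projection_cL2 (projection_cL2 f2).
by apply: inner_ae => //; [apply: ae_eq_sym; exact: idem|exact: ae_eq_refl].
Qed.

Lemma inner_projection_self f : cL2 mu f ->
  inner mu (P f) f = (sqnorm mu (P f))%:C.
Proof. by move=> f2; rewrite inner_projection// inner_self. Qed.

Lemma sqnorm_sub_projection f : cL2 mu f ->
  sqnorm mu (fun x => f x - P f x) = sqnorm mu f - sqnorm mu (P f).
Proof.
move=> f2; have Pf2 := projection_cL2 f2.
rewrite {1}/sqnorm innerBl//; last exact: cL2B.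
rewrite !innerBr// -inner_projection// subrr subr0.
by rewrite -projection_sym// inner_projection_self// inner_self.
Qed.

End Projection.

End Operators.

(** * Projection-valued measures *)
Section SpectralMeasure.
Local Open Scope complex_scope.
Context {d : measure_display} {T : measurableType d} {R : realType}.
Variable mu : {measure set T -> \bar R}.
Variable E : set R -> operator T R.
Hypothesis pvmE : projection_valued_measure mu E.
Implicit Types (f g h u v : T -> R[i]) (a b : R[i]) (B C : set R).

Lemma pvm_lin B : measurable B -> linear_operator mu (E B).
Proof. by move=> mB; exact: projection_lin (pvm_projection pvmE mB). Qed.

Lemma pvm_cL2 B f : measurable B -> cL2 mu f -> cL2 mu (E B f).
Proof. by move=> mB; exact: projection_cL2 (pvm_projection pvmE mB) f. Qed.

Lemma spectral_distE B f : measurable B -> cL2 mu f ->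
  spectral_dist mu E f B = (sqnorm mu (E B f))%:E.
Proof.
move=> mB f2; rewrite /spectral_dist.
by rewrite (inner_projection_self (pvm_projection pvmE mB) f2).
Qed.

(** Strong convergence implies weak convergence: by Cauchy-Schwarz the remainder [w n] contributes
    at most [||w n|| ||f||]. *)
Lemma spectral_dist_sigma_additive f : cL2 mu f ->
  semi_sigma_additive (spectral_dist mu E f).
Proof.
move=> f2 F mF tF mUF.
set U := \bigcup_n F n.
pose w n x := E U f x - \sum_(i < n) E (F i) f x.
have EF2 i : cL2 mu (E (F i) f) by exact: pvm_cL2.
have EU2 : cL2 mu (E U f) by exact: pvm_cL2.
have w2 n : cL2 mu (w n) by exact: (cL2B EU2 (cL2_sum n EF2)).
have w0 : Num.sqrt (sqnorm mu (w n)) @[n --> \oo] --> (0 : R).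
  have := pvm_sigma_additive pvmE mF tF f2.
  have -> : (fun n => cLnorm mu 2%:E (fun x => E U f x - \sum_(i < n) E (F i) f x))
     = (fun n => (Num.sqrt (sqnorm mu (w n)))%:E).
    by apply/funext => n; rewrite cLnorm2_sqnorm//; exact: w2.
  by move=> /fine_cvgP[].
rewrite /spectral_dist; under eq_fun do rewrite sumEFin.
apply: cvg_EFin; first exact: nearW.
pose s := complex.Re (inner mu (E U f) f).
have wE n : s - complex.Re (inner mu (w n) f) =
    \sum_(0 <= i < n) complex.Re (inner mu (E (F i) f) f).
  rewrite innerBl//; last exact: (cL2_sum n EF2).
  rewrite (@inner_suml _ _ _ _ _ (fun i => E (F i) f))// /s big_mkord.
  by rewrite raddfB raddf_sum /=; ring.
rewrite -/U -/s -[X in _ --> X]subr0.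
under eq_fun do rewrite -wE /=.
apply: cvgB; first exact: cvg_cst.
have cw : Num.sqrt (sqnorm mu (w n)) * Num.sqrt (sqnorm mu f) @[n --> \oo] --> (0 : R).
  by rewrite -(mul0r (Num.sqrt (sqnorm mu f))); apply: cvgMl.
apply: (@squeeze_cvgr _ _ _ _
  (fun n => - (Num.sqrt (sqnorm mu (w n)) * Num.sqrt (sqnorm mu f)))
  _ _ _ _ _ cw).
- by apply: nearW => n; rewrite -ler_norml; exact: norm_Re_inner.
- by rewrite -oppr0; exact: cvgN.
Qed.

End SpectralMeasure.

Lemma ge0_integral_setUC {d} {T : measurableType d} {R : realType}
    (m : {measure set T -> \bar R}) (B : set T) (k : T -> R) :
  measurable B -> measurable_fun setT k -> (forall l, 0 <= k l) ->
  (\int[m]_l (k l)%:E =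
   \int[m]_(l in B) (k l)%:E + \int[m]_(l in ~` B) (k l)%:E)%E.
Proof.
move=> mB mk k0; rewrite -(setUv B) ge0_integral_setU//=.
- exact: measurableC.
- by apply/measurable_EFinP; exact: measurable_funTS.
- by move=> l _; rewrite lee_fin.
- by apply/disj_setPS; rewrite setICr.
Qed.

Lemma cst_le_integral {d} {T : measurableType d} {R : realType}
    (m : {measure set T -> \bar R}) (B : set T) (k : T -> R) (r : R) :
  measurable B -> measurable_fun setT k -> 0 <= r ->
  (forall l, B l -> r <= k l) -> (r%:E * m B <= \int[m]_(l in B) (k l)%:E)%E.
Proof.
move=> mB mk r0 rk; rewrite -(integral_cst m mB r%:E).
apply: ge0_le_integral => //.
by apply/measurable_EFinP; exact: measurable_funTS.
Qed.

Lemma integral_le_cst {d} {T : measurableType d} {R : realType}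
    (m : {measure set T -> \bar R}) (B : set T) (k : T -> R) (r : R) :
  measurable B -> measurable_fun setT k ->
  (forall l, B l -> 0 <= k l <= r) -> (\int[m]_(l in B) (k l)%:E <= r%:E * m B)%E.
Proof.
move=> mB mk kr; rewrite -(integral_cst m mB r%:E).
apply: ge0_le_integral => //.
- by move=> l /kr /andP[k0 _]; rewrite lee_fin.
- by apply/measurable_EFinP; exact: measurable_funTS.
- by move=> l /kr /andP[_ lr]; rewrite lee_fin.
Qed.

(** * The finite Borel measure attached to a vector *)

Section SpectralMeasureOfVector.
Local Open Scope complex_scope.
Context {d : measure_display} {T : measurableType d} {R : realType}.
Variable mu : {measure set T -> \bar R}.
Variable E : set R -> operator T R.
Hypothesis pvmE : projection_valued_measure mu E.
Variable f : T -> R[i].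
Hypothesis f2 : cL2 mu f.

(* The library's measures must be nonnegative on all sets, measurable or not. *)
Definition spectral_meas (_ : projection_valued_measure mu E) (_ : cL2 mu f)
    (B : set R) : \bar R :=
  if `[< measurable B >] then spectral_dist mu E f B else 0%E.

Local Notation nu := (spectral_meas pvmE f2).

Lemma spectral_meas_dist B : measurable B -> nu B = spectral_dist mu E f B.
Proof. by move=> mB; rewrite /spectral_meas; case: asboolP. Qed.

Lemma spectral_measE B : measurable B -> nu B = (sqnorm mu (E B f))%:E.
Proof. by move=> mB; rewrite spectral_meas_dist// (spectral_distE pvmE). Qed.

Let nu0 : nu set0 = 0%E.
Proof.
rewrite spectral_measE//; congr EFin.
have m0 : cmeasurable (E set0 f) by case: (pvm_cL2 pvmE measurable0 f2).
have mc0 : @cmeasurable _ T R (fun=> 0) by case: (cL2_0 mu).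
rewrite (sqnorm_ae m0 mc0); last exact: (pvm_set0 pvmE f2).
by rewrite /sqnorm inner0l.
Qed.

Let nu_ge0 B : (0 <= nu B)%E.
Proof.
rewrite /spectral_meas; case: asboolP => // mB.
by rewrite (spectral_distE pvmE)// lee_fin sqnorm_ge0.
Qed.

Let nu_sigma_additive : semi_sigma_additive nu.
Proof.
move=> F mF tF mUF; rewrite spectral_meas_dist//.
under eq_fun do under eq_bigr do rewrite spectral_meas_dist//.
exact: (spectral_dist_sigma_additive pvmE).
Qed.

HB.instance Definition _ :=
  isMeasure.Build _ _ _ nu nu0 nu_ge0 nu_sigma_additive.

Lemma integral_spectral_dist D (g : R -> \bar R) :
  (\int[spectral_dist mu E f]_(l in D) g l = \int[nu]_(l in D) g l)%E.
Proof. by apply: eq_integral_setfun => B mB; rewrite spectral_meas_dist. Qed.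

Lemma spectral_measT : nu setT = (sqnorm mu f)%:E.
Proof.
rewrite spectral_measE//; congr EFin; apply: sqnorm_ae.
- by case: (pvm_cL2 pvmE measurableT f2).
- by case: f2.
- exact: (pvm_setT pvmE).
Qed.

Lemma spectral_meas_fin : fin_num_fun nu.
Proof. by move=> B mB; rewrite spectral_measE. Qed.

HB.instance Definition _ := Measure_isFinite.Build _ _ _ nu spectral_meas_fin.

End SpectralMeasureOfVector.

(** * Functions of a self-adjoint operator *)
Section SpectralCalculus.
Local Open Scope complex_scope.
Context {d : measure_display} {T : measurableType d} {R : realType}.
Variable mu : {measure set T -> \bar R}.
Variable E : set R -> operator T R.
Hypothesis pvmE : projection_valued_measure mu E.
Implicit Types (f g h u v : T -> R[i]) (a b c : R[i]) (B C : set R).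

Local Notation nu f2 := (spectral_meas pvmE f2).

Lemma sqnorm_pvm_setU f B C : cL2 mu f -> measurable B -> measurable C ->
  B `&` C = set0 ->
  sqnorm mu (E (B `|` C) f) = sqnorm mu (E B f) + sqnorm mu (E C f).
Proof.
move=> f2 mB mC BC; apply: EFin_inj; rewrite EFinD.
rewrite -!(spectral_measE pvmE f2)//; last exact: measurableU.
by rewrite measureU.
Qed.

Lemma sqnorm_pvm_le f B C : cL2 mu f -> measurable B -> measurable C ->
  B `<=` C -> sqnorm mu (E B f) <= sqnorm mu (E C f).
Proof.
move=> f2 mB mC BC; rewrite -lee_fin -!(spectral_measE pvmE f2)//.
by rewrite le_measure ?inE.
Qed.

Lemma sqnorm_pvm_setT f : cL2 mu f -> sqnorm mu (E setT f) = sqnorm mu f.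
Proof.
by move=> f2; apply: EFin_inj; rewrite -(spectral_measE pvmE f2)// spectral_measT.
Qed.

Lemma spectral_meas_proj f B C (f2 : cL2 mu f) (g2 : cL2 mu (E B f)) :
  measurable B -> measurable C -> nu g2 C = nu f2 (C `&` B).
Proof.
move=> mB mC; have mCB : measurable (C `&` B) by exact: measurableI.
rewrite !spectral_measE//; congr EFin; apply: sqnorm_ae.
- by case: (pvm_cL2 pvmE mC g2).
- by case: (pvm_cL2 pvmE mCB f2).
- by apply: ae_eq_sym; exact: (pvm_setI pvmE).
Qed.

(** For [C] inside [B], [E(C) (c E(B) f + f) = (1 + c) E(C) f], hence the weight [|1 + c|^2]. Off
    [B] the weight is [1], so that varying [c] isolates the contribution of [B] to a quadratic
    form. *)
Lemma spectral_meas_comb_sub c f B C (f2 : cL2 mu f)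
    (g2 : cL2 mu (fun x => c * E B f x + f x)) :
  measurable B -> measurable C -> C `<=` B ->
  nu g2 C = (((1 + complex.Re c) ^+ 2 + complex.Im c ^+ 2)%:E * nu f2 C)%E.
Proof.
move=> mB mC CB; rewrite !spectral_measE//.
have EC2 := pvm_cL2 pvmE mC f2.
have -> : 1 + complex.Re c = complex.Re (1 + c) by rewrite cReD.
have -> : complex.Im c = complex.Im (1 + c) by rewrite cImD /= add0r.
rewrite -EFinM -sqnormZ//; congr EFin; apply: sqnorm_ae.
- by case: (pvm_cL2 pvmE mC g2).
- by case: (cL2Z (1 + c) EC2).
have EB2 := pvm_cL2 pvmE mB f2.
have := app_lin (pvm_lin pvmE mC) c
  (projection_dom (pvm_projection pvmE mC) EB2)
  (projection_dom (pvm_projection pvmE mC) f2).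
have := pvm_setI pvmE mC mB f2; rewrite setIidl//.
by apply: filterS2 => x /(_ I) + /(_ I) -> _ => <-; rewrite mulrDl mul1r addrC.
Qed.

Lemma spectral_meas_comb_disj c f B C (f2 : cL2 mu f)
    (g2 : cL2 mu (fun x => c * E B f x + f x)) :
  measurable B -> measurable C -> C `<=` ~` B -> nu g2 C = nu f2 C.
Proof.
move=> mB mC CB; rewrite !spectral_measE//; congr EFin.
have EC2 := pvm_cL2 pvmE mC f2.
apply: sqnorm_ae.
- by case: (pvm_cL2 pvmE mC g2).
- by case: EC2.
have EB2 := pvm_cL2 pvmE mB f2.
have := app_lin (pvm_lin pvmE mC) c
  (projection_dom (pvm_projection pvmE mC) EB2)
  (projection_dom (pvm_projection pvmE mC) f2).
have := pvm_setI pvmE mC mB f2; have -> : C `&` B = set0 by rewrite disjoints_subset.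
have := pvm_set0 pvmE f2.
by apply: filterS3 => x /(_ I) -> /(_ I) <- /(_ I) -> _; rewrite mulr0 add0r.
Qed.

Lemma integral_spectral_meas_proj f B (f2 : cL2 mu f) (g2 : cL2 mu (E B f))
    (k : R -> R) : measurable B -> measurable_fun setT k ->
  (forall l, 0 <= k l) ->
  (\int[nu g2]_l (k l)%:E = \int[nu f2]_(l in B) (k l)%:E)%E.
Proof.
move=> mB mk k0; have mB' : measurable (~` B) by exact: measurableC.
have mEk D : measurable_fun D (EFin \o k).
  by apply/measurable_EFinP; exact: measurable_funTS.
rewrite (ge0_integral_setUC (nu g2) mB mk k0).
rewrite [X in (_ + X)%E](_ : _ = 0%E) ?adde0; last first.
  apply: null_set_integral; [exact: mB'|exact: mEk|].
  by rewrite /= (spectral_meas_proj f2)// setICl measure0.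
apply: eq_measure_integral => C mC CB.
by rewrite /= (spectral_meas_proj f2)// setIidl.
Qed.

Lemma integral_spectral_meas_comb c f B (f2 : cL2 mu f)
    (g2 : cL2 mu (fun x => c * E B f x + f x)) (k : R -> R) :
  measurable B -> measurable_fun setT k -> (forall l, 0 <= k l) ->
  (\int[nu g2]_l (k l)%:E =
   ((1 + complex.Re c) ^+ 2 + complex.Im c ^+ 2)%:E
     * \int[nu f2]_(l in B) (k l)%:E + \int[nu f2]_(l in ~` B) (k l)%:E)%E.
Proof.
move=> mB mk k0; have mB' : measurable (~` B) by exact: measurableC.
have mEk D : measurable_fun D (EFin \o k).
  by apply/measurable_EFinP; exact: measurable_funTS.
have c0 : 0 <= (1 + complex.Re c) ^+ 2 + complex.Im c ^+ 2.
  by rewrite addr_ge0 ?sqr_ge0.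
rewrite (ge0_integral_setUC (nu g2) mB mk k0).
have -> : (\int[nu f2]_(l in ~` B) (k l)%:E =
    \int[nu g2]_(l in ~` B) (k l)%:E)%E.
  apply: eq_measure_integral => C mC CB.
  by rewrite /= (spectral_meas_comb_disj f2 g2 mB).
rewrite -(ge0_integral_mscale (nu f2) mB (NngNum c0)) => [| |l _]; last 2 first.
- exact: mEk.
- by rewrite lee_fin.
congr (_ + _)%E; apply: eq_measure_integral => C mC CB.
exact: spectral_meas_comb_sub.
Qed.

Section FunctionOf.
Variables (phi : R -> R) (S : operator T R).
Hypothesis mphi : measurable_fun setT phi.
Hypothesis phi_ge0 : forall l, 0 <= phi l.
Hypothesis ES : function_of mu E phi S.

Let linS : linear_operator mu S. Proof. by case: ES. Qed.

Lemma function_of_dom_proj f B : measurable B -> dom S f -> dom S (E B f).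
Proof.
move=> mB; case: ES => _ -> _ [f2 /=].
have EB2 := pvm_cL2 pvmE mB f2.
rewrite (integral_spectral_dist pvmE f2) => lf; split => //=.
rewrite (integral_spectral_dist pvmE EB2).
rewrite (integral_spectral_meas_proj f2 EB2)//; last 2 first.
- exact: measurable_funX.
- by move=> l; exact: sqr_ge0.
apply: le_lt_trans lf; apply: ge0_subset_integral => //.
- by apply/measurable_EFinP; exact: measurable_funX.
- by move=> l _; rewrite lee_fin sqr_ge0.
Qed.

(** [phi <= 1 + phi^2], and constants are integrable for the finite measure of [f]. *)
Lemma function_of_integrable f (f2 : cL2 mu f) : dom S f ->
  (nu f2).-integrable setT (EFin \o phi).
Proof.
case: ES => _ -> _ [_ /=]; rewrite (integral_spectral_dist pvmE f2) => lf.
have i1 : (nu f2).-integrable setT (EFin \o cst 1).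
  exact: finite_measure_integrable_cst.
have i2 : (nu f2).-integrable setT (fun l => (phi l ^+ 2)%:E).
  apply/integrableP; split.
    by apply/measurable_EFinP; exact: measurable_funX.
  by under eq_integral do rewrite gee0_abs ?lee_fin ?sqr_ge0//.
apply: le_integrable (integrableD measurableT i1 i2) => //.
  exact/measurable_EFinP.
move=> l _ /=; rewrite lee_fin ger0_norm ?phi_ge0// ger0_norm.
  by have := sqr_ge0 (phi l - 1); nra.
by rewrite addr_ge0// sqr_ge0.
Qed.

(* Polarization: the forms of [c E(B) f + f] for [c = 1] and [c = i] determine
   [<S f, E(B) f>]. *)
Lemma inner_function_of_proj f B (f2 : cL2 mu f) : measurable B -> dom S f ->
  inner mu (S f) (E B f) = (fine (\int[nu f2]_(l in B) (phi l)%:E)%E)%:C.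
Proof.
move=> mB Sf; have mB' : measurable (~` B) by exact: measurableC.
have Sg := function_of_dom_proj mB Sf.
have intphi := function_of_integrable f2 Sf.
have fin D : measurable D -> (\int[nu f2]_(l in D) (phi l)%:E)%E \is a fin_num.
  move=> mD; apply: integrable_fin_num => //.
  exact: integrableS intphi.
set I := fine _; pose J := fine (\int[nu f2]_(l in ~` B) (phi l)%:E)%E.
have SE u : dom S u -> inner mu (S u) u =
    (fine (\int[spectral_dist mu E u]_l (phi l)%:E)%E)%:C.
  by case: ES => _ _; apply.
have EB2 := dom_cL2 linS Sg.
have Sc c : dom S (fun x => c * E B f x + f x) by exact: (dom_lin linS c Sg Sf).
have Q c : inner mu (S (fun x => c * E B f x + f x)) (fun x => c * E B f x + f x)
    = (((1 + complex.Re c) ^+ 2 + complex.Im c ^+ 2) * I + J)%:C.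
  have c2 := dom_cL2 linS (Sc c).
  rewrite SE// (integral_spectral_dist pvmE c2).
  rewrite (integral_spectral_meas_comb f2)// fineD ?fin//.
    by rewrite fineM// fin.
  by rewrite fin_numM// fin.
have Qg : inner mu (S (E B f)) (E B f) = I%:C.
  rewrite SE// (integral_spectral_dist pvmE EB2).
  by rewrite (integral_spectral_meas_proj f2).
have Qf : inner mu (S f) f = (I + J)%:C.
  have := Q 0; rewrite /= addr0 expr1n expr0n addr0 mul1r => <-.
  have -> : (fun x => 0 * E B f x + f x) = f.
    by apply/funext => x; rewrite mul0r add0r.
  by [].
have Sf2 := app_cL2 linS Sf; have Sg2 := app_cL2 linS Sg.
have {}Q c : c * (c^* * I%:C + inner mu (S (E B f)) f) +
    (c^* * inner mu (S f) (E B f) + (I + J)%:C) =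
    (((1 + complex.Re c) ^+ 2 + complex.Im c ^+ 2) * I + J)%:C.
  rewrite -Q inner_app_lin//; last exact: cL2_lin.
  by rewrite !inner_linr// Qg Qf.
move: (inner mu (S f) (E B f)) (inner mu (S (E B f)) f) Q => z w Q.
(* [c = 1] gives [z + w = 2 I] and [c = 'i] gives [z = w]; hence [z = I]. *)
have := congr1 (@complex.Re R) (Q 1); have := congr1 (@complex.Im R) (Q 1).
have := congr1 (@complex.Re R) (Q 'i); have := congr1 (@complex.Im R) (Q 'i).
rewrite !ReImE /= => h1 h2 h3 h4.
by apply: complex_eqP => /=; lra.
Qed.

(* Cauchy-Schwarz for [<E(B) S f, E(B) f> = \int_B phi d<E f, f>]; this replaces
   the identity [||S f||^2 = \int phi^2 d<E f, f>]. *)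
Lemma sqnorm_proj_function_of f B (r : R) : measurable B -> dom S f ->
  0 <= r -> (forall l, B l -> r <= phi l) ->
  r ^+ 2 * sqnorm mu (E B f) <= sqnorm mu (E B (S f)).
Proof.
move=> mB Sf r0 rphi; have f2 := dom_cL2 linS Sf.
have Sf2 := app_cL2 linS Sf.
have EB2 := pvm_cL2 pvmE mB f2; have ES2 := pvm_cL2 pvmE mB Sf2.
have := inner_function_of_proj f2 mB Sf; set I := fine _ => IE.
have rI : r * sqnorm mu (E B f) <= I.
  rewrite -lee_fin fineK; last first.
    apply: integrable_fin_num => //.
    by apply: integrableS (function_of_integrable f2 Sf).
  rewrite EFinM -(spectral_measE pvmE f2)//.
  exact: (cst_le_integral (nu f2)).
have := cauchy_schwarz ES2 EB2.
rewrite (projection_sym (pvm_projection pvmE mB))//.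
have -> : inner mu (S f) (E B (E B f)) = I%:C.
  rewrite -(projection_sym (pvm_projection pvmE mB))//.
  rewrite -(inner_projection (pvm_projection pvmE mB))//.
  by rewrite (projection_sym (pvm_projection pvmE mB)).
move=> /=; have := sqnorm_ge0 mu (E B f); have := sqnorm_ge0 mu (E B (S f)).
move: (sqnorm mu (E B f)) (sqnorm mu (E B (S f))) rI => n s rI s0 n0 le.
(* Now [(r n)^2 <= I^2 <= s n], and dividing by [n] gives the claim when [n] is nonzero. *)
have [->|n_neq0] := eqVneq n 0; first by rewrite mulr0.
have np : 0 < n by rewrite lt_neqAle eq_sym n_neq0.
rewrite -(ler_pM2r np); apply: le_trans le; rewrite -mulrA -expr2 -exprMn.
by rewrite lerXn2r ?nnegrE ?mulr_ge0//; apply: le_trans rI; rewrite mulr_ge0.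
Qed.

End FunctionOf.
End SpectralCalculus.

(** * Spectral lower bound for the energy; spectral support of a positive operator *)

Section SpectralEstimates.
Local Open Scope complex_scope.
Context {d : measure_display} {T : measurableType d} {R : realType}.
Variable mu : {measure set T -> \bar R}.
Variable E : set R -> operator T R.
Hypothesis pvmE : projection_valued_measure mu E.
Implicit Types (f g h u v : T -> R[i]) (a b c : R[i]) (B C : set R).

Local Notation nu f2 := (spectral_meas pvmE f2).

(* A Riemann sum of [\int_0^oo <E(]l,oo[) f,f> dl <= \int l d<E(l) f,f>]. *)
Lemma riemann_sum_le_energy (S : operator T R) f (e : R) (n : nat) :
  function_of mu E Num.sqrt S -> dom S f -> 0 < e ->
  \sum_(k < n) e * sqnorm mu (E `]k.+1%:R * e, +oo[%classic f)
    <= sqnorm mu (S f).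
Proof.
move=> ES Sf e0; have linS : linear_operator mu S by case: ES.
have f2 := dom_cL2 linS Sf; have Sf2 := app_cL2 linS Sf.
have ke0 k : 0 <= k%:R * e :> R by rewrite mulr_ge0// ltW.
have chunk k B : measurable B -> (forall l, B l -> k%:R * e <= l) ->
    k%:R * e * sqnorm mu (E B f) <= sqnorm mu (E B (S f)).
  move=> mB kB; rewrite -[k%:R * e]sqr_sqrtr//.
  apply: (sqnorm_proj_function_of pvmE _ _ ES) => //.
  - exact: (continuous_measurable_fun (@sqrt_continuous R)).
  - by move=> l Bl; exact/ler_wsqrtr/kB.
have split_tail g k : cL2 mu g ->
    sqnorm mu (E `]k%:R * e, +oo[%classic g) =
    sqnorm mu (E `]k%:R * e, k.+1%:R * e]%classic g) +
    sqnorm mu (E `]k.+1%:R * e, +oo[%classic g).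
  move=> g2; rewrite -sqnorm_pvm_setU//.
    congr (sqnorm mu (E _ _)); rewrite -itv_bndbnd_setU//= bnd_simp.
    by rewrite ler_pM2r// ler_nat.
  apply/seteqP; split=> // l [] /=; rewrite !in_itv/= andbT.
  by move=> /andP[_ lk] /(le_lt_trans lk); rewrite ltxx.
(* Summation by parts as an induction: from [n] to [n.+1] the interval []n e, (n+1) e]] is split off
   both tails, and [chunk] compares the two pieces. At the end [n e ||E(]n e, oo[) f||^2] is
   absorbed by the tail of [S f], again by [chunk]. *)
suff step : \sum_(k < n) e * sqnorm mu (E `]k.+1%:R * e, +oo[%classic f)
    + sqnorm mu (E `]n%:R * e, +oo[%classic (S f))
    <= n%:R * e * sqnorm mu (E `]n%:R * e, +oo[%classic f)
       + sqnorm mu (E `]0%:R * e, +oo[%classic (S f)).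
  have := chunk n _ (measurable_itv `]n%:R * e, +oo[)
    (fun l => ltac:(by rewrite /= in_itv/= andbT => /ltW)).
  have : sqnorm mu (E `]0%:R * e, +oo[%classic (S f)) <= sqnorm mu (S f).
    by rewrite -(sqnorm_pvm_setT pvmE Sf2); exact: sqnorm_pvm_le.
  lra.
have alg (s a b c t x z : R) : s + (c + t) <= x * (a + b) + z ->
    x * a <= c -> s + e * b + t <= (x + e) * b + z by lra.
elim: n => [|n IH]; first by rewrite big_ord0 !mul0r.
rewrite big_ord_recr /=.
set b := sqnorm mu (E `]n.+1%:R * e, +oo[%classic f).
have -> : n.+1%:R * e * b = (n%:R * e + e) * b by rewrite -natr1 mulrDl mul1r.
apply: alg (chunk n _ (measurable_itv `]n%:R * e, n.+1%:R * e]) _).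
  by move: IH; rewrite (split_tail f)// (split_tail (S f) n).
by move=> l; rewrite /= in_itv/= => /andP[/ltW].
Qed.

Section PositiveOperator.
Variable A : operator T R.
Hypothesis EA : function_of mu E id A.
Hypothesis posA : positive_operator mu A.

Let linA : linear_operator mu A. Proof. by case: EA. Qed.

Lemma dom_proj_bounded f B (M : R) : cL2 mu f -> measurable B ->
  (forall l, B l -> `|l| <= M) -> dom A (E B f).
Proof.
move=> f2 mB BM; have EB2 := pvm_cL2 pvmE mB f2.
have msqr : measurable_fun [set: R] (fun l : R => l ^+ 2).
  exact: measurable_funX (@measurable_id _ _ _).
case: EA => _ -> _; split => //=.
rewrite (integral_spectral_dist pvmE EB2).
rewrite (integral_spectral_meas_proj pvmE f2 EB2)//; last first.
  by move=> l; exact: sqr_ge0.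
apply: (@le_lt_trans _ _ ((M ^+ 2)%:E * nu f2 B)%E).
  apply: (integral_le_cst (nu f2)) => // l /BM lM; rewrite sqr_ge0 /=.
  by rewrite -real_normK ?num_real// lerXn2r// nnegrE (le_trans _ lM).
by rewrite (spectral_measE pvmE f2 mB) -EFinM ltey.
Qed.

(** Boundedness of [B] puts [E B f] in the domain of [A]. There positivity makes the integral of [l]
    over [B] nonnegative, whereas it is at most [- e ||E B f||^2]. *)
Lemma pvm_negative_bounded f B (M e : R) : cL2 mu f -> measurable B ->
  0 < e -> (forall l, B l -> - M <= l <= - e) -> sqnorm mu (E B f) = 0.
Proof.
move=> f2 mB e0 Be; have EB2 := pvm_cL2 pvmE mB f2.
have mB' : measurable (~` B) by exact: measurableC.
have domB : dom A (E B f).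
  apply: (dom_proj_bounded (M := M)) => // l /Be /andP[lM le].
  by rewrite ler_norml lM /=; lra.
(* The integral lemmas want a nonnegative integrand on the whole line: [k] is the negative part of
   the identity and equals [- l] on [B], which carries the measure of [E B f]. *)
pose k l : R := Num.max (- l) 0.
have k0 l : 0 <= k l by rewrite le_max lexx orbT.
have mk : measurable_fun setT k.
  by apply: measurable_maxr => //; exact: measurable_funN.
have idk : (\int[nu EB2]_l l%:E = - \int[nu EB2]_l (k l)%:E)%E.
  rewrite -integral_ge0N; last by move=> l _; rewrite lee_fin.
  apply: ae_eq_integral => //.
  - by have /measurable_EFinP := measurable_funN mk.
  - exists (~` B); split => //.
      by rewrite /= (spectral_meas_proj pvmE f2)// setICl measure0.
    move=> l /= H Bl; apply: H => _.
    have /andP[_ le] := Be _ Bl.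
    by rewrite /k max_l ?opprK//; lra.
have kB : (\int[nu EB2]_l (k l)%:E = \int[nu f2]_(l in B) (k l)%:E)%E.
  exact: integral_spectral_meas_proj.
have nuBE := spectral_measE pvmE f2 mB.
have k_le := integral_le_cst (nu f2) (r := M) mB mk.
have le_k := cst_le_integral (nu f2) (r := e) mB mk (ltW e0).
have {}k_le : (\int[nu f2]_(l in B) (k l)%:E <= (M * sqnorm mu (E B f))%:E)%E.
  rewrite EFinM -nuBE; apply: k_le => l /Be /andP[lM le].
  by rewrite k0 /k max_l; lra.
have {}le_k : ((e * sqnorm mu (E B f))%:E <= \int[nu f2]_(l in B) (k l)%:E)%E.
  rewrite EFinM -nuBE; apply: le_k => l /Be /andP[lM le].
  by rewrite /k max_l; lra.
have kfin : (\int[nu f2]_(l in B) (k l)%:E)%E \is a fin_num.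
  rewrite ge0_fin_numE; last by apply: integral_ge0 => l _; rewrite lee_fin.
  exact: le_lt_trans k_le (ltey _).
have := posA domB; case: EA => _ _ /(_ _ domB) ->.
rewrite (integral_spectral_dist pvmE EB2) idk kB lecE /= eqxx /=.
rewrite fineN oppr_ge0 => k_le0.
have : e * sqnorm mu (E B f) <= 0.
  by rewrite -lee_fin; apply: le_trans le_k _; rewrite -(fineK kfin) lee_fin.
rewrite (pmulr_rle0 _ e0) => ?.
by apply/eqP; rewrite eq_le sqnorm_ge0 andbT.
Qed.

(** The half-line is exhausted by the intervals [[-(n+1), -1/(n+1)]], which are bounded and stay
    away from [0]. *)
Lemma pvm_negative f : cL2 mu f -> sqnorm mu (E `]-oo, 0[%classic f) = 0.
Proof.
move=> f2; apply: EFin_inj; rewrite -(spectral_measE pvmE f2)//.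
have null n : nu f2 `[- n.+1%:R, - n.+1%:R^-1]%classic = 0%E.
  rewrite spectral_measE//; congr EFin.
  by apply: (@pvm_negative_bounded _ _ n.+1%:R n.+1%:R^-1).
apply/(negligibleP (nu f2)) => //.
apply: (@negligibleS _ _ _ (nu f2)
   (\bigcup_n `[- (n.+1%:R : R), - n.+1%:R^-1]%classic)).
  move=> l /=; rewrite in_itv/= => l0.
  pose n := maxn (Num.truncn (- l)) (Num.truncn (- l)^-1).
  have p0 : 0 < - l by rewrite oppr_gt0.
  exists n => //=; rewrite in_itv /=; apply/andP; split.
    rewrite lerNl; apply/ltW/(lt_le_trans (truncnS_gt _)).
    by rewrite ler_nat ltnS leq_maxl.
  rewrite lerNr -[leRHS]invrK lef_pV2 ?posrE ?invr_gt0//.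
  apply/ltW/(lt_le_trans (truncnS_gt _)).
  by rewrite ler_nat ltnS leq_maxr.
apply: negligible_bigcup => n; apply/negligibleP; [exact: measurable_itv|].
exact: null.
Qed.

Hypothesis saA : self_adjoint mu A.

(* A positive form vanishing at [g = E({0}) f] vanishes on [g] against every
   vector, and [A = A^*] turns this into [A g = 0]. *)
Lemma op_ker_pvm0 f : cL2 mu f -> op_ker mu A (E [set 0] f).
Proof.
move=> f2; have m0 : measurable [set (0 : R)] by exact: measurable_set1.
have g2 := pvm_cL2 pvmE m0 f2; set g := E _ f in g2 *.
have domg : dom A g.
  by apply: (dom_proj_bounded (M := 0)) => // l ->; rewrite normr0.
have Agg : inner mu (A g) g = 0.
  case: EA => _ _ ->//; rewrite (integral_spectral_dist pvmE g2).
  have -> : (\int[nu g2]_l l%:E = \int[nu g2]_l cst 0 l)%E.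
    apply: ae_eq_integral => //.
    exists (~` [set 0]); split => //; first exact: measurableC.
      rewrite /= (spectral_meas_proj pvmE f2)//; last exact: measurableC.
      by rewrite setICl measure0.
    by move=> l /= H l0; apply: H => _; rewrite l0.
  by rewrite integral0.
have [_ _ adj] := saA.
have Ag2 := app_cL2 linA domg.
have [_ _ symg] : adjoint_graph mu A g (A g).
  by apply/adj; split => //; exact: ae_eq_refl.
have Ahg h : dom A h -> inner mu (A h) g = 0.
  move=> domh; have h2 := dom_cL2 linA domh; have Ah2 := app_cL2 linA domh.
  set z := inner mu (A h) g.
  have Agh : inner mu (A g) h = z^* by rewrite (innerJ h2 Ag2) -symg.
  have pos c : 0 <= complex.Re (c * z^* + c^* * z + inner mu (A h) h).
    have := posA (dom_lin linA c domg domh).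
    rewrite inner_app_lin//; last exact: cL2_lin.
    rewrite !inner_linr// Agg Agh mulr0 add0r addrA lecE => /andP[_].
    by rewrite /z.
  move: (inner mu (A h) h) pos => w pos; clearbody z.
  (* As [<A g, g> = 0], the form at [c g + h] is affine in [c]. Along [c = t z] its slope is
     [2 |z|^2], so it stays nonnegative for all [t] only if [z = 0]. *)
  have {}pos t : 0 <= 2 * t * (complex.Re z ^+ 2 + complex.Im z ^+ 2)
      + complex.Re w.
    apply: le_trans (pos (t%:C * z)) _.
    by rewrite !ReImE /= le_eqVlt; apply/orP; left; apply/eqP; ring.
  move: (complex.Re w) pos => {}w pos.
  have [z0|z0] := eqVneq (complex.Re z ^+ 2 + complex.Im z ^+ 2) 0.
    have := sqr_ge0 (complex.Re z); have := sqr_ge0 (complex.Im z).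
    move=> i0 r0; apply: complex_eqP => /=; apply/eqP;
    by rewrite -sqrf_eq0; apply/eqP; lra.
  have := pos (- (w + 1) / (2 * (complex.Re z ^+ 2 + complex.Im z ^+ 2))).
  have eqN1 (q : R) : q != 0 -> 2 * (- (w + 1) / (2 * q)) * q + w = - 1.
    by move=> q0; field.
  by rewrite eqN1// lerNr oppr0 ler10.
split=> //; have : adjoint_graph mu A g (fun=> 0).
  split => //; first exact: cL2_0.
  move=> h domh; rewrite Ahg// (innerJ (cL2_0 mu) (dom_cL2 linA domh)) inner0l.
  by apply: complex_eqP; rewrite ?cReJ ?cImJ //= oppr0.
by move=> /adj[_ _]; exact: ae_eq_sym.
Qed.

(** Since [E({0}) f] lies in the kernel, [||E({0}) f||^2 = <f, E({0}) f> = 0]; the open half-line is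
    null by positivity. *)
Lemma pvm_nonpositive f : orthocomplement mu (op_ker mu A) f ->
  sqnorm mu (E `]-oo, 0]%classic f) = 0.
Proof.
move=> [f2 fker]; have m0 : measurable [set (0 : R)] by exact: measurable_set1.
have -> : `]-oo, 0]%classic = `]-oo, 0[%classic `|` [set (0 : R)].
  by rewrite setUitv1.
rewrite sqnorm_pvm_setU// ?pvm_negative ?add0r//; last first.
  apply/seteqP; split=> // l [] /=; rewrite in_itv/= => /[swap] ->.
  by rewrite ltxx.
have := fker _ (op_ker_pvm0 f2).
rewrite -(projection_sym (pvm_projection pvmE m0))//.
rewrite (inner_projection_self (pvm_projection pvmE m0))//.
by move=> /(congr1 (@complex.Re R)).
Qed.

Lemma sqnorm_sub_low f (l : R) : orthocomplement mu (op_ker mu A) f -> 0 < l ->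
  sqnorm mu (fun x => f x - E `]0, l]%classic f x) =
  sqnorm mu (E `]l, +oo[%classic f).
Proof.
move=> fV l0; have [f2 _] := fV.
rewrite (sqnorm_sub_projection (pvm_projection pvmE _))//.
rewrite -[in LHS](sqnorm_pvm_setT pvmE f2).
have -> : [set: R] = `]-oo, 0]%classic `|` (`]0, l]%classic `|` `]l, +oo[%classic).
  by rewrite -itv_bndbnd_setU// -?itv_bndbnd_setU// ?set_itvE// bnd_simp// ltW.
have disj1 : `]-oo, 0] `&` (`]0, l] `|` `]l, +oo[) = set0 :> set R.
  apply/seteqP; split=> // x []; rewrite /= !in_itv/= => x0 [/andP[]|].
    by move=> /(le_lt_trans x0); rewrite ltxx.
  by rewrite andbT => /lt_le_trans /(_ x0) /(lt_trans l0); rewrite ltxx.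
have disj2 : `]0, l] `&` `]l, +oo[ = set0 :> set R.
  apply/seteqP; split=> // x []; rewrite /= !in_itv/= andbT => /andP[_ xl].
  by move=> /(le_lt_trans xl); rewrite ltxx.
have [m1 m2 m3] : [/\ measurable (`]-oo, 0] : set R),
  measurable (`]0, l] : set R) & measurable (`]l, +oo[ : set R)] by split.
rewrite (sqnorm_pvm_setU pvmE f2 m1 (measurableU _ _ m2 m3) disj1).
rewrite (sqnorm_pvm_setU pvmE f2 m2 m3 disj2).
by rewrite pvm_nonpositive// add0r addrC addKr.
Qed.

End PositiveOperator.
End SpectralEstimates.

(** * The norm from L^1 to L^oo *)
Section SupNorm.
Local Open Scope complex_scope.
Context {d : measure_display} {T : measurableType d} {R : realType}.
Variable mu : {measure set T -> \bar R}.
Implicit Types (P : operator T R) (f g h u v : T -> R[i]) (a b c : R[i]).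

Lemma cLnorm1E f : cLnorm mu 1%E f = (\int[mu]_x (cmod f x)%:E)%E.
Proof.
rewrite /cLnorm Lnorm1; apply: eq_integral => x _ /=.
by rewrite ger0_norm ?cmod_ge0.
Qed.

Lemma cL1P f : cL1 mu f <->
  cmeasurable f /\ mu.-integrable setT (EFin \o cmod f).
Proof.
have absE : (\int[mu]_x `|(cmod f x)%:E| = \int[mu]_x (cmod f x)%:E)%E.
  by apply: eq_integral => x _; rewrite gee0_abs// lee_fin cmod_ge0.
split=> [[mf]|[mf /integrableP[_]]].
- rewrite cLnorm1E => lf; split=> //; apply/integrableP; split.
    by apply/measurable_EFinP; exact: measurable_cmod.
  by rewrite /= absE.
- by rewrite /= absE -cLnorm1E.
Qed.

Definition norm1 f : R := fine (cLnorm mu 1%E f).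

Lemma norm1_ge0 f : 0 <= norm1 f.
Proof. by rewrite fine_ge0// Lnorm_ge0. Qed.

Lemma integral_cmod f : cL1 mu f -> (\int[mu]_x (cmod f x)%:E = (norm1 f)%:E)%E.
Proof.
move=> /cL1P[mf lf]; rewrite /norm1 cLnorm1E fineK//.
exact: integrable_fin_num.
Qed.

Lemma norm1_eq0 f : cL1 mu f -> norm1 f = 0 -> f = (fun=> 0) %[ae mu].
Proof.
move=> f1 f0; have [mf _] := f1.
have m : measurable_fun setT (EFin \o cmod f).
  by apply/measurable_EFinP; exact: measurable_cmod.
have : (\int[mu]_x `|(cmod f x)%:E| = 0)%E.
  rewrite -[RHS]/(0%:E) -f0 -integral_cmod//; apply: eq_integral => x _.
  by rewrite gee0_abs// lee_fin cmod_ge0.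
move=> /(ae_eq_integral_abs mu measurableT m).
by apply: filterS => x /= /(_ I) [] fx0 _; exact: cmod_eq0.
Qed.

Lemma cmodZ a f x : cmod (fun x => a * f x) x = ComplexField.Normc.normc a * cmod f x.
Proof. exact: ComplexField.Normc.normcM. Qed.

Lemma cmodZr (r : R) f x : 0 <= r -> cmod (fun x => r%:C * f x) x = r * cmod f x.
Proof. by move=> r0; rewrite cmodZ /= expr0n addr0 sqrtr_sqr ger0_norm. Qed.

Lemma cL1Zr (r : R) f : 0 <= r -> cL1 mu f -> cL1 mu (fun x => r%:C * f x).
Proof.
move=> r0 /cL1P[mf lf]; apply/cL1P; split.
  have mc0 : @cmeasurable _ T R (fun=> 0) by case: (cL2_0 mu).
  by have := cmeasurable_lin r%:C mf mc0; under eq_fun do rewrite addr0.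
have := integrableZl measurableT r lf; apply: eq_integrable => // x _ /=.
by rewrite cmodZr// EFinM.
Qed.

Lemma norm1Zr (r : R) f : 0 <= r -> cL1 mu f ->
  norm1 (fun x => r%:C * f x) = r * norm1 f.
Proof.
move=> r0 f1; apply: EFin_inj; rewrite EFinM -!integral_cmod//; last exact: cL1Zr.
rewrite -ge0_integralZl_EFin//.
- by apply: eq_integral => x _; rewrite cmodZr// EFinM.
- by move=> x _; rewrite lee_fin cmod_ge0.
- by apply/measurable_EFinP; apply: measurable_cmod; case: f1.
Qed.

Lemma cmod0 (x : T) : cmod (fun=> 0 : R[i]) x = 0 :> R.
Proof. exact: ComplexField.Normc.normc0. Qed.

Lemma cLnormooP f (r : R) : 0 <= r ->
  (cLnorm mu +oo%E f <= r%:E)%E <-> \forall x \ae mu, cmod f x <= r.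
Proof.
move=> r0; rewrite /cLnorm unlock.
have absE x : (abse \o (EFin \o cmod f)) x = (cmod f x)%:E.
  by rewrite /= ger0_norm ?cmod_ge0.
case: ifPn => [_|].
  split=> [/ess_supP|H].
    by apply: filterS => x /=; rewrite lee_fin ger0_norm ?cmod_ge0.
  by apply/ess_supP; apply: filterS H => x; rewrite absE lee_fin.
(* On a space of measure zero the [L^oo] norm is [0] by convention, and every property holds almost
   everywhere. *)
rewrite -leNgt measure_le0 => /eqP muT0; split=> [_|_]; last by rewrite lee_fin.
exists setT; split=> //.
Qed.

Lemma norm1oo_ge0 P : (0 <= norm1oo mu P)%E.
Proof.
apply: (@le_trans _ _ (cLnorm mu +oo%E (P (fun=> 0)))); first exact: Lnorm_ge0.
apply: ereal_sup_ubound; exists (fun=> 0) => //; split; [|exact: cL2_0|].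
- apply/cL1P; split; first by case: (cL2_0 mu).
  apply: (eq_integrable measurableT (cst 0%E)) => [x _|]; last exact: integrable0.
  by rewrite /= cmod0.
- rewrite cLnorm1E integral0_eq ?lee_fin// => x _.
  by rewrite cmod0.
Qed.

Lemma norm1oo_bound P g (r : R) : linear_operator mu P -> dom P = cL2 mu ->
  (norm1oo mu P <= r%:E)%E -> cL1 mu g -> cL2 mu g ->
  \forall x \ae mu, cmod (P g) x <= r * norm1 g.
Proof.
move=> linP domP Pr g1 g2.
have r0 : 0 <= r by rewrite -lee_fin (le_trans (norm1oo_ge0 P)).
have domg a : dom P (fun x => a * g x) by rewrite domP; exact: cL2Z.
have Pg : dom P g by rewrite domP.
(* The bound comes from normalizing [g] in [L^1]. If its norm is zero, [g] agrees almost everywhere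
   with [0 * g], and so does [P g] with [0 * P g]. *)
have [n0|n0] := eqVneq (norm1 g) 0.
  have g0 : g = (fun x => 0 * g x) %[ae mu].
    apply: filterS (norm1_eq0 g1 n0) => x /(_ I) -> _.
    by rewrite mul0r.
  have := appZ linP 0 Pg.
  have := app_ae linP Pg (cL2Z 0 g2) g0.
  apply: filterS2 => x /(_ I) Pg0 /(_ I) P0; rewrite n0 mulr0.
  by rewrite /cmod Pg0 P0 mul0r ComplexField.Normc.normc0.
have np : 0 < norm1 g by rewrite lt_neqAle eq_sym n0 norm1_ge0.
have ni : 0 <= (norm1 g)^-1 by rewrite invr_ge0 norm1_ge0.
set k := fun x => ((norm1 g)^-1)%:C * g x.
have : (cLnorm mu +oo%E (P k) <= r%:E)%E.
  apply: le_trans Pr; apply: ereal_sup_ubound; exists k => //.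
  split; [exact: cL1Zr|exact: cL2Z|].
  rewrite cLnorm1E integral_cmod; last exact: cL1Zr.
  by rewrite norm1Zr// mulVf.
move=> /(cLnormooP _ r0).
have := appZ linP ((norm1 g)^-1)%:C Pg.
apply: filterS2 => x /(_ I) Pk.
rewrite {1}/cmod Pk -/(cmod (fun x => ((norm1 g)^-1)%:C * P g x) x) cmodZr//.
by rewrite ler_pdivrMl// mulrC.
Qed.

Lemma normr_Re_mulJ a b :
  `|complex.Re (a * b^*)| <=
  ComplexField.Normc.normc a * ComplexField.Normc.normc b.
Proof.
rewrite -sqrtr_sqr; case: a b => [p q] [s t] /=.
rewrite -sqrtrM ?addr_ge0 ?sqr_ge0// ler_wsqrtr//.
by have := sqr_ge0 (p * t - q * s); nra.
Qed.

(** [||P g||_2^2 = <P g, g> <= ||P g||_oo ||g||_1]. *)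
Lemma sqnorm_projection_norm1 P g (r : R) : orthogonal_projection mu P ->
  (norm1oo mu P <= r%:E)%E -> cL1 mu g -> cL2 mu g ->
  sqnorm mu (P g) <= r * norm1 g ^+ 2.
Proof.
move=> projP Pr g1 g2.
have r0 : 0 <= r by rewrite -lee_fin (le_trans (norm1oo_ge0 P)).
have linP := projection_lin projP; have Pg2 := projection_cL2 projP g2.
have := norm1oo_bound linP _ Pr g1 g2; case: (projP) => _ -> _ _ /(_ erefl) Pgx.
have -> : sqnorm mu (P g) = complex.Re (inner mu (P g) g).
  by rewrite (inner_projection_self projP).
have [intR _] := cL2_cintegrable_mulJ Pg2 g2.
apply: le_trans (ler_norm _) _.
apply: le_trans (le_normr_Rintegral measurableT intR) _.
have intA := integrable_norm intR.
rewrite -lee_fin fineK; last exact: (integrable_fin_num measurableT intA).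
have -> : (r * norm1 g ^+ 2)%:E = (\int[mu]_x ((r * norm1 g)%:E * (cmod g x)%:E))%E.
  rewrite ge0_integralZl_EFin ?mulr_ge0 ?norm1_ge0//.
  - by rewrite integral_cmod// -EFinM -mulrA -expr2.
  - by move=> x _; rewrite lee_fin cmod_ge0.
  - by apply/measurable_EFinP; apply: measurable_cmod; case: g1.
apply: ae_ge0_le_integral => //.
- by case/integrableP: intA.
- by move=> x _; rewrite -EFinM lee_fin !mulr_ge0 ?cmod_ge0 ?norm1_ge0.
- apply/measurable_EFinP; apply: measurable_funM => //.
  by apply: measurable_cmod; case: g1.
apply: filterS Pgx => x Pgx _; rewrite -EFinM lee_fin.
apply: le_trans (normr_Re_mulJ _ _) _.
by apply: ler_wpM2r Pgx; exact: cmod_ge0.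
Qed.

End SupNorm.

(** * Monotonicity of the spectral density and the level-set estimate *)

Section SpectralDensity.
Local Open Scope complex_scope.
Context {d : measure_display} {T : measurableType d} {R : realType}.
Variable mu : {measure set T -> \bar R}.
Variable E : set R -> operator T R.
Hypothesis pvmE : projection_valued_measure mu E.
Implicit Types (f g h u v : T -> R[i]).

(* [<E(]0,l]) g, k> = <E(]0,l]) g, E(]0,l]) k>] is controlled by the norms of
   [E(]0,m]) g] and [E(]0,m]) k], hence by [||E(]0,m])||_{1,oo}]; the test
   function [k] is [E(]0,l]) g] cut off where it is large. *)
Lemma spectral_density_nd (l m : R) : l <= m ->
  (spectral_density mu E l <= spectral_density mu E m)%E.
Proof.
move=> lm; rewrite /spectral_density.
have := norm1oo_ge0 mu (E `]0, m]%classic).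
case Fm : (norm1oo mu (E `]0, m]%classic)) => [r||] //; last first.
  by move=> _; rewrite leey.
rewrite lee_fin => r0; apply/ge_ereal_sup => _ [g [g1 g2 gle1] <-].
have ml : measurable (`]0, l] : set R) by [].
have mm : measurable (`]0, m] : set R) by [].
have n1g : norm1 mu g <= 1 by rewrite -lee_fin -integral_cmod// -cLnorm1E.
set p := E `]0, l]%classic g.
have p2 : cL2 mu p by exact: pvm_cL2.
have mp : measurable_fun setT (cmod p) by apply: measurable_cmod; case: p2.
have sq_le k : cL1 mu k -> cL2 mu k ->
    sqnorm mu (E `]0, l]%classic k) <= r * norm1 mu k ^+ 2.
  move=> k1 k2; apply: (@le_trans _ _ (sqnorm mu (E `]0, m]%classic k))).
    by apply: (sqnorm_pvm_le pvmE) => //; apply: subset_itvl; rewrite bnd_simp.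
  apply: sqnorm_projection_norm1 => //; last by rewrite Fm.
  exact: pvm_projection pvmE _ mm.
suff large_null e : 0 < e -> \forall x \ae mu, cmod p x <= r + e.
  apply/(cLnormooP _ _ r0).
  have := ae_foralln (fun n => large_null n.+1%:R^-1 ltac:(by [])).
  apply: filterS => x H; apply/ler_addgt0Pr => e e0.
  apply: le_trans (H (Num.truncn e^-1)) _; rewrite lerD2l.
  rewrite -[leRHS]invrK lef_pV2 ?posrE ?invr_gt0//.
  exact/ltW/truncnS_gt.
move=> e0; have re0 : 0 < r + e by exact: ltr_wpDl.
pose D := [set x | r + e < cmod p x].
have mD : measurable D.
  have -> : D = setT `&` cmod p @^-1` `]r + e, +oo[.
    by apply/seteqP; split=> x /=; rewrite in_itv/= andbT; [split|case].
  exact: mp.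
(* [p] is only known to lie in [L^2]; cut off to [D] it also lies in [L^1], because
   [|k| <= |p|^2 / (r + e)]. *)
pose k x : R[i] := (\1_D x : R)%:C * p x.
have cmodk x : cmod k x = \1_D x * cmod p x.
  rewrite /k /cmod ComplexField.Normc.normcM /= expr0n addr0 sqrtr_sqr.
  by rewrite ger0_norm// indicE.
have mk : cmeasurable k.
  have [[pr pi] _] := p2.
  have mi : measurable_fun setT (\1_D : T -> R) by exact: measurable_indic.
  split.
  - apply: eq_measurable_fun (measurable_funM mi pr) => x _.
    by rewrite /k cReM /= mul0r subr0.
  - apply: eq_measurable_fun (measurable_funM mi pi) => x _.
    by rewrite /k cImM /= mul0r addr0.
have ind01 x : 0 <= (\1_D x : R) <= 1.
  by rewrite indicE; case: (_ \in _); rewrite /= ?lexx ?ler01.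
have k2 : cL2 mu k.
  apply/cL2P; split=> //; have /cL2P[_ lp] := p2.
  apply: le_integrable lp => //.
    by apply/measurable_EFinP; apply: measurable_funX; exact: measurable_cmod.
  move=> x _; rewrite !abse_EFin lee_fin !ger0_norm ?sqr_ge0//.
  rewrite lerXn2r ?nnegrE ?cmod_ge0//.
  rewrite cmodk -[leRHS]mul1r; apply: ler_wpM2r; first exact: cmod_ge0.
  by case/andP: (ind01 x).
have le_k x : (r + e) * cmod k x <= \1_D x * cmod p x ^+ 2.
  rewrite cmodk indicE; have [|_] := boolP (x \in D).
    rewrite inE => /ltW Dx; rewrite !mul1r expr2.
    by rewrite ler_wpM2r ?cmod_ge0.
  by rewrite !mul0r mulr0.
have k1 : cL1 mu k.
  apply/cL1P; split=> //; have /cL2P[_ lp] := p2.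
  apply: le_integrable (integrableZl measurableT (r + e)^-1 lp) => //.
    by apply/measurable_EFinP; exact: measurable_cmod.
  move=> x _; rewrite -EFinM !abse_EFin lee_fin !ger0_norm ?cmod_ge0//; last first.
    by rewrite mulr_ge0 ?sqr_ge0// invr_ge0 ltW.
  rewrite ler_pdivlMl//; apply: le_trans (le_k x) _.
  by rewrite -[leRHS]mul1r ler_wpM2r ?sqr_ge0//; case/andP: (ind01 x).
have low : (r + e) * norm1 mu k <= complex.Re (inner mu p k).
  have [intR _] := cL2_cintegrable_mulJ p2 k2.
  rewrite -lee_fin EFinM -integral_cmod// -ge0_integralZl_EFin//; last 3 first.
  - by move=> x _; rewrite lee_fin cmod_ge0.
  - by apply/measurable_EFinP; exact: measurable_cmod.
  - exact: ltW.
  rewrite /= fineK; last exact: (integrable_fin_num measurableT intR).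
  have ReE x : complex.Re (p x * (k x)^*) = \1_D x * cmod p x ^+ 2.
    by rewrite cmod_sqr /k !ReImE /=; ring.
  apply: ge0_le_integral => //.
  - by move=> x _; rewrite -EFinM lee_fin mulr_ge0 ?cmod_ge0 ?(ltW re0).
  - apply/measurable_EFinP; apply: measurable_funM => //.
    exact: measurable_cmod.
  - by case/integrableP: intR.
  - by move=> x _; rewrite -EFinM lee_fin ReE.
have up : complex.Re (inner mu p k) <= r * norm1 mu k.
  have projl := pvm_projection pvmE ml.
  rewrite (inner_projection projl g2 k2).
  apply: le_trans (ler_norm _) _.
  apply: le_trans (norm_Re_inner _ _) _; [exact: pvm_cL2|exact: pvm_cL2|].
  rewrite -sqrtrM ?sqnorm_ge0//.
  (* The factor [1] is the bound on [||g||_1^2]. *)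
  have -> : r * norm1 mu k = Num.sqrt ((r * 1) * (r * norm1 mu k ^+ 2)).
    rewrite mulr1 mulrA -expr2 -exprMn sqrtr_sqr ger0_norm//.
    by rewrite mulr_ge0 ?norm1_ge0.
  apply/ler_wsqrtr/ler_pM; rewrite ?sqnorm_ge0 ?sq_le//.
  apply: le_trans (sq_le _ g1 g2) _; apply: ler_wpM2l => //.
  by rewrite expr_le1 ?norm1_ge0.
(* [low] and [up] give [(r + e) ||k||_1 <= r ||k||_1] with [e > 0]. *)
have k0 : norm1 mu k = 0.
  apply/eqP; rewrite eq_le norm1_ge0 andbT -(pmulr_rle0 _ e0).
  by rewrite -(lerD2l (r * norm1 mu k)) addr0 -mulrDl (le_trans low).
apply: filterS (norm1_eq0 k1 k0) => x /(_ I) kx.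
have := cmodk x; rewrite /cmod kx ComplexField.Normc.normc0 => /esym/eqP.
rewrite mulf_eq0 => /orP[|/eqP p0]; last first.
  by rewrite /cmod p0; exact: ltW.
rewrite indicE pnatr_eq0 eqb0 => /negP xD.
by rewrite leNgt; apply/negP => px; apply: xD; rewrite inE.
Qed.

Section Energy.
Variable A : operator T R.
Hypothesis EA : function_of mu E id A.
Hypothesis posA : positive_operator mu A.
Hypothesis saA : self_adjoint mu A.
Variable f : T -> R[i].
Hypothesis fV : orthocomplement mu (op_ker mu A) f.
Hypothesis f1 : cL1 mu f.
Hypothesis n1_gt0 : 0 < norm1 mu f.

Let f2 : cL2 mu f. Proof. by case: fV. Qed.

Local Notation y x := (cmod f x / (2 * norm1 mu f)).

Lemma measurable_level (c : R) : measurable [set x | c <= y x].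
Proof.
have -> : [set x | c <= y x] = setT `&` (fun x => y x) @^-1` `[c, +oo[.
  by apply/seteqP; split=> x /=; rewrite in_itv/= andbT; [split|case].
have [mf _] := f1.
by apply: (measurable_funM (measurable_cmod mf) (measurable_cst _)).
Qed.

Lemma level_sqr_le_tail (l c : R) : 0 < l ->
  (spectral_density mu E l <= c%:E)%E ->
  (\int[mu]_x (cmod f x ^+ 2 * \1_[set x | c <= y x] x)%:E
     <= (4 * sqnorm mu (E `]l, +oo[%classic f))%:E)%E.
Proof.
move=> l0 Flc; have ml : measurable (`]0, l] : set R) by [].
have mi : measurable_fun setT (\1_[set x | c <= y x] : T -> R).
  by apply: measurable_indic; exact: measurable_level.
have Pf2 := pvm_cL2 pvmE ml f2.
have h2 := cL2B f2 Pf2.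
have mf : measurable_fun setT (cmod f) by apply: measurable_cmod; case: f2.
have mh : measurable_fun setT (cmod (fun x => f x - E `]0, l]%classic f x)).
  by apply: measurable_cmod; case: h2.
rewrite -(sqnorm_sub_low pvmE EA)// EFinM -integral_cmod2//.
rewrite -ge0_integralZl_EFin//; last 2 first.
- by move=> x _; rewrite lee_fin sqr_ge0.
- by apply/measurable_EFinP; exact: measurable_funX.
have projl := pvm_projection pvmE ml.
have bnd : \forall x \ae mu, cmod (E `]0, l]%classic f) x <= c * norm1 mu f.
  apply: norm1oo_bound => //; first exact: projection_lin projl.
  by case: projl.
apply: ae_ge0_le_integral => //.
- by move=> x _; rewrite lee_fin mulr_ge0 ?sqr_ge0// indicE.
- by apply/measurable_EFinP; apply: measurable_funM => //; exact: measurable_funX.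
- by move=> x _; rewrite -EFinM lee_fin mulr_ge0 ?sqr_ge0.
- apply/measurable_EFinP; apply: measurable_funM => //.
  exact: measurable_funX.
apply: filterS bnd => x Pfx _; rewrite -EFinM lee_fin indicE.
have [|_] := boolP (x \in _); last by rewrite mulr0 mulr_ge0 ?sqr_ge0.
rewrite inE /= ler_pdivlMr ?mulr_gt0// mulr1 => cf.
have tri : cmod f x <= cmod (fun x => f x - E `]0, l]%classic f x) x
    + cmod (E `]0, l]%classic f) x.
  apply: le_trans _ (le_normcD _ _).
  by rewrite /cmod subrK.
have -> : 4 = 2 ^+ 2 :> R by rewrite -natrX.
rewrite -exprMn lerXn2r ?nnegrE ?cmod_ge0 ?mulr_ge0 ?cmod_ge0//.
by move: tri Pfx cf; lra.
Qed.

End Energy.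
End SpectralDensity.

(** * Convexity and integral inequalities *)
Section RealConvexity.
Context {R : realType}.
Variable phi : R -> R.
Hypothesis phi_convex : convex_function (R := R) (E := R^o) `[0, +oo[%classic phi.

Lemma convex_functionE (t x y : R) : 0 <= x -> 0 <= y -> 0 <= t -> t <= 1 ->
  phi (t * x + (1 - t) * y) <= t * phi x + (1 - t) * phi y.
Proof.
move=> x0 y0 t0 t1; apply: (phi_convex (Itv01 t0 t1));
by rewrite inE /= in_itv /= andbT.
Qed.

Lemma convex_chord (u m v : R) : 0 <= u -> u < m -> m < v ->
  (phi m - phi u) / (m - u) <= (phi v - phi m) / (v - m).
Proof.
move=> u0 um mv.
have uv : 0 < v - u by lra.
have t0 : 0 <= (v - m) / (v - u) by apply: divr_ge0; lra.
have t1 : (v - m) / (v - u) <= 1 by rewrite ler_pdivrMr//; lra.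
have v0 : 0 <= v by lra.
have := convex_functionE u0 v0 t0 t1.
have -> : (v - m) / (v - u) * u + (1 - (v - m) / (v - u)) * v = m.
  by field; lra.
have -> : (v - m) / (v - u) * phi u + (1 - (v - m) / (v - u)) * phi v
    = ((v - m) * phi u + (m - u) * phi v) / (v - u) by field; lra.
rewrite ler_pdivlMr// => H.
rewrite ler_pdivrMr; last by lra.
rewrite mulrAC ler_pdivlMr; last by lra.
by move: H; lra.
Qed.

(** The slope is the supremum of the chord slopes to the left of [m], which every slope to the right
    bounds. [m > 0] provides the chord from [0], so the supremum is over a nonempty set. *)
Lemma convex_support_line (m : R) : 0 < m ->
  exists s, forall y, 0 <= y -> phi m + s * (y - m) <= phi y.
Proof.
move=> m0.
pose X := [set (phi m - phi u) / (m - u) | u in [set u | 0 <= u < m]].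
have ubX v : m < v -> ubound X ((phi v - phi m) / (v - m)).
  by move=> mv _ [u /andP[u0 um] <-]; exact: convex_chord.
have supX : has_sup X.
  split; first by exists ((phi m - phi 0) / (m - 0)); exists 0; rewrite //= lexx.
  by exists ((phi (m + 1) - phi m) / (m + 1 - m)); apply: ubX; lra.
exists (sup X) => y y0.
have [ym|my|->] := ltgtP y m; last by rewrite subrr mulr0 addr0.
- have : (phi m - phi y) / (m - y) <= sup X.
    by apply: ub_le_sup; [case: supX|exists y; rewrite //= y0].
  by rewrite ler_pdivrMr; lra.
- have : sup X <= (phi y - phi m) / (y - m).
    by apply: ge_sup; [case: supX|exact: ubX].
  by rewrite ler_pdivlMr; lra.
Qed.

(** [a] is the combination of [b] and [0] with weight [a / b] on [b]. *)
Lemma convex_le_scale (a b : R) : phi 0 = 0 -> 0 < a -> a <= b ->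
  phi a <= a / b * phi b.
Proof.
move=> p0 a0 ab; have b0 : 0 < b by exact: lt_le_trans ab.
have := convex_functionE (ltW b0) (lexx 0) (divr_ge0 (ltW a0) (ltW b0)) _.
rewrite mulr0 addr0 p0 mulr0 addr0 divfK ?gt_eqF//; apply.
by rewrite ler_pdivrMr// mul1r.
Qed.

End RealConvexity.

Section IntegralInequalities.
Context {d : measure_display} {T : measurableType d} {R : realType}.
Variable mu : {measure set T -> \bar R}.

(* No measurability is needed: the integral of a nonnegative function is a
   supremum over the simple functions below it. *)
Lemma ge0_le_integral_setT (f g : T -> \bar R) :
  (forall x, (0 <= f x)%E) -> (forall x, (f x <= g x)%E) ->
  (\int[mu]_x f x <= \int[mu]_x g x)%E.
Proof.
move=> f0 fg; have g0 x := le_trans (f0 x) (fg x).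
rewrite !ge0_integralTE//; apply: ereal_sup_le => _ [h hf <-].
by exists h => // x; exact: le_trans (hf x) (fg x).
Qed.

(** Meant for the supporting line in Jensen's inequality, which may take negative values; its
    negative part only lowers the integral. *)
Lemma le_integral_setT (f g : T -> \bar R) :
  (forall x, (0 <= g x)%E) -> (forall x, (f x <= g x)%E) ->
  (\int[mu]_x f x <= \int[mu]_x g x)%E.
Proof.
move=> g0 fg; rewrite integralE.
apply: (@le_trans _ _ (\int[mu]_x f^\+ x)%E).
  rewrite -[leRHS]adde0; apply: leeD2l.
  by rewrite oppe_le0; apply: integral_ge0 => x _; exact: funeneg_ge0.
apply: ge0_le_integral_setT => x; first exact: funepos_ge0.
by rewrite funeposE ge_max fg g0.
Qed.

End IntegralInequalities.

Section LimInf.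
Context {R : realType}.
Implicit Types (u : (\bar R)^nat) (c : \bar R).

Lemma limn_einf_ge u c N : (forall n, (N <= n)%N -> (c <= u n)%E) ->
  (c <= limn_einf u)%E.
Proof.
move=> cu; rewrite limn_einf_lim; apply: lime_ge; first exact: is_cvg_einfs.
exists N => // n /= Nn; apply: le_ereal_inf_tmp => _ [k /= nk <-].
by apply: cu; exact: leq_trans nk.
Qed.

Lemma limn_einf_le u c : (forall n, (u n <= c)%E) -> (limn_einf u <= c)%E.
Proof.
move=> uc; rewrite limn_einf_lim; apply: lime_le; first exact: is_cvg_einfs.
apply: nearW => n; apply: le_trans (uc n).
by apply: ereal_inf_lbound; exists n => /=.
Qed.

End LimInf.

(** * The energy estimates *)
Section FaberKrahn.
Local Open Scope complex_scope.
Context {d : measure_display} {T : measurableType d} {R : realType}.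
Variable mu : {measure set T -> \bar R}.
Variable E : set R -> operator T R.
Hypothesis pvmE : projection_valued_measure mu E.

Lemma spectral_density0 : (spectral_density mu E 0 <= 0)%E.
Proof.
apply: ge_ereal_sup => _ [g [g1 g2 _] <-].
apply/(cLnormooP _ _ (lexx 0)); rewrite set_itvoc0.
apply: filterS (pvm_set0 pvmE g2) => x /(_ I) gx.
by rewrite /cmod gx ComplexField.Normc.normc0.
Qed.

Lemma rc_inverse_ge0 (r : R) : 0 <= r ->
  (0 <= rc_inverse (spectral_density mu E) r)%E.
Proof.
move=> r0; apply: ereal_sup_ubound; exists 0 => //=; split => //.
by apply: le_trans spectral_density0 _; rewrite lee_fin.
Qed.

Variable A : operator T R.
Hypothesis EA : function_of mu E id A.
Hypothesis posA : positive_operator mu A.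
Hypothesis saA : self_adjoint mu A.
Variable S : operator T R.
Hypothesis ES : function_of mu E Num.sqrt S.
Hypothesis F_fin : forall l : R, 0 < l -> (spectral_density mu E l < +oo)%E.
Variable f : T -> R[i].
Hypothesis fV : orthocomplement mu (op_ker mu A) f.
Hypothesis f1 : cL1 mu f.
Hypothesis n1_gt0 : 0 < norm1 mu f.
Hypothesis Sf : dom S f.

Let f2 : cL2 mu f. Proof. by case: fV. Qed.

Local Notation y x := (cmod f x / (2 * norm1 mu f)).
Local Notation F := (spectral_density mu E).

Let y_ge0 x : 0 <= y x.
Proof. by rewrite divr_ge0 ?cmod_ge0// mulr_ge0// ltW. Qed.

(* Riemann sum, of step [1/(n+1)], of [F^{-1}(y x) = \int_0^oo 1(F l <= y x) dl]. *)
Let rsum (n : nat) (x : T) : R := \sum_(k < n.+1 * n.+1)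
  n.+1%:R^-1 * \1_[set x | fine (F (k.+1%:R / n.+1%:R)) <= y x] x.

Let F_ge0 l : (0 <= F l)%E. Proof. exact: norm1oo_ge0. Qed.

Let F_fineK l : 0 < l -> (fine (F l))%:E = F l.
Proof. by move=> l0; rewrite fineK// ge0_fin_numE// F_fin. Qed.

Let rsum_ge0 n x : 0 <= rsum n x.
Proof. by apply: sumr_ge0 => k _; rewrite mulr_ge0// indicE. Qed.

(** By monotonicity of [F], every node [(k+1)/(n+1) <= l] is counted. There are [K], the integer
    part of [l (n+1)], of them; [l <= n+1] keeps [K] within the [(n+1)^2] terms of the sum, and
    rounding costs at most one step. *)
Lemma rsum_ge (n : nat) (x : T) (l : R) : 0 <= l -> (F l <= (y x)%:E)%E ->
  l <= n.+1%:R -> l - n.+1%:R^-1 <= rsum n x.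
Proof.
move=> l0 Fl ln; have n0 : 0 < n.+1%:R :> R by [].
pose K := Num.truncn (l * n.+1%:R).
have ln0 : 0 <= l * n.+1%:R by rewrite mulr_ge0.
have /andP[Kle Kgt] := truncn_itv ln0; rewrite -/K in Kle Kgt.
have KN : (K <= n.+1 * n.+1)%N.
  rewrite -(ler_nat R); apply: le_trans Kle _.
  by rewrite natrM ler_wpM2r.
apply: (@le_trans _ _ (K%:R / n.+1%:R)).
  rewrite lerBlDr -{2}[n.+1%:R^-1]mul1r -mulrDl natr1 ler_pdivlMr//.
  exact: ltW.
have -> : K%:R / n.+1%:R = \sum_(k < K) (n.+1%:R^-1 : R).
  by rewrite sumr_const card_ord mulr_natl.
rewrite (big_ord_widen _ (fun=> n.+1%:R^-1 : R) KN) big_mkcond /=.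
apply: ler_sum => k _; case: ifPn => [kK|_]; last by rewrite mulr_ge0// indicE.
rewrite indicE mem_set ?mulr1//= -lee_fin F_fineK ?divr_gt0//.
apply: le_trans Fl; apply: (spectral_density_nd pvmE).
by rewrite ler_pdivrMr// (le_trans _ Kle)// ler_nat.
Qed.

(** Each node contributes a level set, bounded by four times a spectral tail; the tails of step
    [1/(n+1)] sum to at most the energy, uniformly in [n]. *)
Lemma integral_rsum_le n :
  (\int[mu]_x (cmod f x ^+ 2 * rsum n x)%:E <= (4 * sqnorm mu (S f))%:E)%E.
Proof.
have mf : measurable_fun setT (cmod f) by apply: measurable_cmod; case: f2.
have e0 : 0 < n.+1%:R^-1 :> R by [].
pose c k : R := fine (F (k.+1%:R / n.+1%:R)).
have mi k : measurable_fun setT (\1_[set x | c k <= y x] : T -> R).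
  by apply: measurable_indic; exact: (measurable_level f1).
have mG k : measurable_fun setT
    (fun x => (cmod f x ^+ 2 * \1_[set x | c k <= y x] x)%:E).
  by apply/measurable_EFinP; apply: measurable_funM => //; exact: measurable_funX.
have G0 k x : (0 <= (cmod f x ^+ 2 * \1_[set x | c k <= y x] x)%:E)%E.
  by rewrite lee_fin mulr_ge0 ?sqr_ge0// indicE.
have -> : (\int[mu]_x (cmod f x ^+ 2 * rsum n x)%:E =
   \int[mu]_x \sum_(k < n.+1 * n.+1) ((n.+1%:R^-1)%:E *
      (cmod f x ^+ 2 * \1_[set x | c k <= y x] x)%:E))%E.
  apply: eq_integral => x _; rewrite /rsum mulr_sumr -sumEFin.
  by apply: eq_bigr => k _; rewrite -EFinM mulrCA.
rewrite ge0_integral_sum//; last 2 first.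
- by move=> k; apply: measurable_funeM; exact: mG.
- by move=> k x _; rewrite mule_ge0// lee_fin ltW.
apply: (@le_trans _ _ (\sum_(k < n.+1 * n.+1)
   (4 * (n.+1%:R^-1 * sqnorm mu (E `]k.+1%:R / n.+1%:R, +oo[%classic f)))%:E)%E).
  apply: lee_sum => k _; rewrite ge0_integralZl_EFin//.
  rewrite mulrCA EFinM; apply: lee_wpmul2l; first by rewrite lee_fin ltW.
  apply: (level_sqr_le_tail pvmE EA posA saA fV f1 n1_gt0).
    by rewrite divr_gt0.
  by rewrite F_fineK// divr_gt0.
rewrite sumEFin lee_fin -mulr_sumr ler_pM2l//.
exact: (riemann_sum_le_energy pvmE).
Qed.

(** Fatou's lemma asks only for this inequality, so it suffices to bound the Riemann sums from below
    for each single [l] in the supremum defining the inverse. *)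
Lemma sqr_rc_inverse_le_liminf x :
  ((cmod f x ^+ 2)%:E * rc_inverse F (y x) <=
   limn_einf (fun n => (cmod f x ^+ 2 * rsum n x)%:E))%E.
Proof.
set L := limn_einf _.
have L0 : (0 <= L)%E.
  by apply: (@limn_einf_ge _ _ _ 0) => n _; rewrite lee_fin mulr_ge0 ?sqr_ge0.
(* Where [f x = 0] the left side is [0] even if the inverse is infinite. *)
have [p0|p0] := eqVneq (cmod f x ^+ 2) 0; first by rewrite p0 mul0e.
have pp : 0 < cmod f x ^+ 2 by rewrite lt_neqAle eq_sym p0 sqr_ge0.
case LE : L L0 => [r||] // _; last by rewrite leey.
have : (rc_inverse F (y x) <= (r / cmod f x ^+ 2)%:E)%E.
  apply: ge_ereal_sup => _ [l [l0 Fl] <-]; rewrite lee_fin ler_pdivlMr//.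
  apply/ler_addgt0Pr => e e0.
  (* For [n >= N] the first entry ensures [l <= n+1], the second [|f x|^2 / (n+1) <= e]. *)
  pose N := maxn (Num.truncn l) (Num.truncn (cmod f x ^+ 2 / e)).
  suff : ((l * cmod f x ^+ 2 - e)%:E <= L)%E.
    by rewrite LE lee_fin lerBlDr.
  apply: (@limn_einf_ge _ _ _ N) => n; rewrite geq_max => /andP[n1 n2].
  rewrite lee_fin; apply: (@le_trans _ _ (cmod f x ^+ 2 * (l - n.+1%:R^-1))).
    rewrite mulrBr mulrC lerD2l lerN2 ler_pdivrMr// mulrC -ler_pdivrMr//.
    apply/ltW/(lt_le_trans (truncnS_gt _)).
    by rewrite ler_nat ltnS.
  rewrite ler_pM2l//; apply: rsum_ge => //.
  apply/ltW/(lt_le_trans (truncnS_gt _)).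
  by rewrite ler_nat ltnS.
move=> /(lee_wpmul2l (_ : (0 <= (cmod f x ^+ 2)%:E)%E)).
rewrite lee_fin sqr_ge0 => /(_ isT) /le_trans; apply.
by rewrite -EFinM mulrC divfK.
Qed.

Lemma integral_sqr_rc_inverse_le :
  (\int[mu]_x ((cmod f x ^+ 2)%:E * rc_inverse F (y x))
     <= (4 * sqnorm mu (S f))%:E)%E.
Proof.
have mrsum n : measurable_fun setT (rsum n).
  apply: measurable_sum => k; apply: measurable_funM => //.
  by apply: measurable_indic; exact: (measurable_level f1).
apply: (@le_trans _ _
  (\int[mu]_x limn_einf (fun n => (cmod f x ^+ 2 * rsum n x)%:E))%E).
  apply: ge0_le_integral_setT => x; last exact: sqr_rc_inverse_le_liminf.
  by rewrite mule_ge0 ?lee_fin ?sqr_ge0// rc_inverse_ge0.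
apply: le_trans (limn_einf_le integral_rsum_le).
apply: fatou => //.
- move=> n; apply/measurable_EFinP; apply: measurable_funM => //.
  by apply: measurable_funX; apply: measurable_cmod; case: f1.
- by move=> n x _; rewrite lee_fin mulr_ge0 ?sqr_ge0.
Qed.

Section Convex.
Variable phi : R -> R.
Hypothesis phi_convex : convex_function (R := R) (E := R^o) `[0, +oo[%classic phi.
Hypothesis phi_le : forall r : R, 0 <= r ->
  0 <= phi r /\ ((phi r)%:E <= r%:E * rc_inverse F r)%E.

Let phi0 : phi 0 = 0.
Proof.
have [p0] := phi_le (lexx 0); rewrite mul0e lee_fin => p1.
by apply/eqP; rewrite eq_le p1.
Qed.

Hypothesis n2_gt0 : 0 < sqnorm mu f.

(* Jensen for the probability measure [|f| dmu / ||f||_1]. *)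
Lemma convex_energy_le :
  norm1 mu f ^+ 2 * phi (sqnorm mu f / (2 * norm1 mu f ^+ 2))
    <= 2 * sqnorm mu (S f).
Proof.
have := n1_gt0; set n1 := norm1 mu f => n1p; set m := sqnorm mu f / _.
have m0 : 0 < m by rewrite divr_gt0// mulr_gt0// exprn_gt0.
have [s sP] := convex_support_line phi_convex m0.
(* [m] is the mean of [y = |f| / (2 n1)]. The supporting line at [m], multiplied by [2 n1 |f|],
   reads [a |f| + s |f|^2], because [2 n1 y = |f|]. *)
pose a := 2 * n1 * (phi m - s * m).
have /cL1P[_ lf] := f1; have /cL2P[_ lf2] := f2.
have ia := integrableZl measurableT a lf.
have is2 := integrableZl measurableT s lf2.
have : (\int[mu]_x (a%:E * (cmod f x)%:E + s%:E * (cmod f x ^+ 2)%:E)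
    <= (4 * sqnorm mu (S f))%:E)%E.
  apply: le_trans integral_sqr_rc_inverse_le; apply: le_integral_setT => x.
    by rewrite mule_ge0 ?lee_fin ?sqr_ge0// rc_inverse_ge0.
  (* The same factor turns [y F^{-1}(y)] into [|f|^2 F^{-1}(y)]. *)
  have [_] := phi_le (y_ge0 x).
  move=> /(lee_wpmul2l (_ : (0 <= (2 * n1 * cmod f x)%:E)%E)).
  rewrite lee_fin !mulr_ge0 ?cmod_ge0 ?(ltW n1p)// => /(_ isT).
  rewrite muleA -!EFinM.
  have -> : 2 * n1 * cmod f x * (cmod f x / (2 * norm1 mu f)) = cmod f x ^+ 2.
    by rewrite -/n1; field; rewrite gt_eqF.
  apply: le_trans; rewrite -EFinD lee_fin.
  have -> : a * cmod f x + s * cmod f x ^+ 2 =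
      2 * n1 * cmod f x * (phi m + s * (y x - m)).
    by rewrite /a -/n1; field; rewrite gt_eqF.
  apply: ler_wpM2l; last exact: sP.
  by rewrite !mulr_ge0 ?cmod_ge0 ?(ltW n1p).
rewrite integralD// !integralZl// integral_cmod// integral_cmod2// -!EFinM -EFinD.
rewrite lee_fin -/n1.
have -> : a * n1 + s * sqnorm mu f = 2 * (n1 ^+ 2 * phi m).
  by rewrite /a /m; field; rewrite gt_eqF.
by lra.
Qed.

(** Cauchy-Schwarz for [|f|] and the indicator of [Omega], both seen as complex-valued functions. *)
Lemma norm1_sqr_le_support (Omega : set T) : measurable Omega ->
  (mu Omega < +oo)%E -> f = (fun=> 0) %[ae mu in ~` Omega] ->
  norm1 mu f ^+ 2 <= fine (mu Omega) * sqnorm mu f.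
Proof.
move=> mO Ofin f0.
have mf : measurable_fun setT (cmod f) by apply: measurable_cmod; case: f2.
have mi : measurable_fun setT (\1_Omega : T -> R) by exact: measurable_indic.
have cmodC (k : T -> R) x : 0 <= k x -> cmod (fun x => (k x)%:C) x = k x.
  by move=> k0; rewrite /cmod /= expr0n addr0 sqrtr_sqr ger0_norm.
have mC (k : T -> R) : measurable_fun setT k -> cmeasurable (fun x => (k x)%:C).
  by move=> mk; split => //=; exact: measurable_cst.
have Oint : (\int[mu]_x (\1_Omega x)%:E = mu Omega)%E.
  by rewrite integral_indic// setIT.
have i1 x : (cmod (fun x => (\1_Omega x : R)%:C) x) ^+ 2 = \1_Omega x.
  by rewrite cmodC indicE; case: (_ \in _); rewrite //= ?expr1n ?expr0n.
have v2 : cL2 mu (fun x => (\1_Omega x : R)%:C).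
  apply/cL2P; split; first exact: mC.
  under eq_fun do rewrite i1.
  apply/integrableP; split; first exact/measurable_EFinP.
  under eq_integral do rewrite gee0_abs ?lee_fin ?indicE//.
  by rewrite Oint.
have u2 : cL2 mu (fun x => (cmod f x)%:C).
  apply/cL2P; split; first exact: mC.
  have /cL2P[_] := f2; apply: eq_integrable => // x _.
  by rewrite cmodC ?cmod_ge0.
have := cauchy_schwarz u2 v2.
have -> : sqnorm mu (fun x => (cmod f x)%:C) = sqnorm mu f.
  rewrite !sqnormE; congr fine; apply: eq_integral => x _.
  by rewrite cmodC ?cmod_ge0.
have -> : sqnorm mu (fun x => (\1_Omega x : R)%:C) = fine (mu Omega).
  by rewrite sqnormE -Oint; congr fine; apply: eq_integral => x _; rewrite i1.
have -> : complex.Re (inner mu (fun x => (cmod f x)%:C)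
    (fun x => (\1_Omega x : R)%:C)) = norm1 mu f.
  rewrite /norm1 cLnorm1E; congr fine; apply: ge0_ae_eq_integral => //.
  - apply/measurable_EFinP; apply: eq_measurable_fun (measurable_funM mf mi) => x _.
    by rewrite !ReImE /=; ring.
  - exact/measurable_EFinP.
  - move=> x _; rewrite lee_fin !ReImE /= oppr0 mulr0 subr0.
    by rewrite mulr_ge0 ?cmod_ge0// indicE.
  - by move=> x _; rewrite lee_fin cmod_ge0.
  apply: filterS f0 => x f0 _; congr EFin; rewrite !ReImE /= oppr0 mulr0 subr0.
  rewrite indicE; have [_|xO] := boolP (x \in Omega); first by rewrite mulr1.
  rewrite mulr0 /cmod f0 ?ComplexField.Normc.normc0//.
  by move: xO; rewrite notin_setE.
by rewrite mulrC.
Qed.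

Lemma convex_energy_support (Omega : set T) : measurable Omega ->
  (mu Omega < +oo)%E -> f = (fun=> 0) %[ae mu in ~` Omega] ->
  fine (mu Omega) * phi (1 / (2 * fine (mu Omega)))
    <= 2 * sqnorm mu (S f) / sqnorm mu f.
Proof.
move=> mO Ofin f0; have := norm1_sqr_le_support mO Ofin f0.
set w := fine (mu Omega) => n1w.
have n1p : 0 < norm1 mu f ^+ 2 by rewrite exprn_gt0.
have w0 : 0 < w by rewrite -(pmulr_lgt0 _ n2_gt0) (lt_le_trans n1p).
have a0 : 0 < 1 / (2 * w) by rewrite divr_gt0// mulr_gt0.
have ab : 1 / (2 * w) <= sqnorm mu f / (2 * norm1 mu f ^+ 2).
  rewrite ler_pdivrMr ?mulr_gt0// mulrAC ler_pdivlMr ?mulr_gt0//.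
  by move: n1w; lra.
rewrite ler_pdivlMr//; apply: le_trans convex_energy_le.
(* The ratio of the two arguments is [||f||_1^2 / (w ||f||_2^2)], so multiplying by [w ||f||_2^2]
   leaves exactly the left side of [convex_energy_le]. *)
have := convex_le_scale phi_convex phi0 a0 ab.
rewrite -(ler_pM2l (mulr_gt0 w0 n2_gt0)) mulrAC => /le_trans; apply.
rewrite le_eqVlt; apply/orP; left; apply/eqP; field.
by rewrite !gt_eqF.
Qed.

End Convex.

End FaberKrahn.

Theorem theorem1p3 (d : measure_display) (T : measurableType d) (R : realType)
    (mu : {measure set T -> \bar R})
    (A : operator T R) (E : set R -> operator T R) (sqrtA : operator T R)
    (hA : self_adjoint mu A) (hApos : positive_operator mu A)
    (hE : spectral_measure mu E A)
    (hsqrtA : function_of mu E Num.sqrt sqrtA)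
    (hF : forall l : R, 0 < l -> (spectral_density mu E l < +oo)%E)
    (f : T -> R[i])
    (fV : orthocomplement mu (op_ker mu A) f)
    (fL1 : cL1 mu f)
    (fn0 : ~ (f = (fun=> 0) %[ae mu])) :
  let Finv := rc_inverse (spectral_density mu E) in
  let n1 := fine (cLnorm mu 1%E f) in
  let n2 := fine (cLnorm mu 2%:E f) in
  [/\ (\int[mu]_x (((cmod f x) ^+ 2)%:E * Finv (cmod f x / (2 * n1))%R)
         <= 4%:E * energy mu sqrtA f)%E,
      (forall phi : R -> R,
        convex_function (R := R) (E := R^o) `[0, +oo[%classic phi ->
        (forall y : R, 0 <= y -> 0 <= phi y /\ ((phi y)%:E <= y%:E * Finv y)%E) ->
        ((n1 ^+ 2 * phi (n2 ^+ 2 / (2 * n1 ^+ 2)))%:E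
           <= 2%:E * energy mu sqrtA f)%E) &
      (forall phi : R -> R,
        convex_function (R := R) (E := R^o) `[0, +oo[%classic phi ->
        (forall y : R, 0 <= y -> 0 <= phi y /\ ((phi y)%:E <= y%:E * Finv y)%E) ->
        forall Omega : set T, measurable Omega -> (mu Omega < +oo)%E ->
        dom A f ->
        f = (fun=> 0) %[ae mu in ~` Omega] ->
        A f = (fun=> 0) %[ae mu in ~` Omega] ->
        ((fine (mu Omega) * phi (1 / (2 * fine (mu Omega))))%:E
           <= 2%:E * energy mu sqrtA f / (n2 ^+ 2)%:E)%E)].
Proof.
move=> Finv n1 n2.
have [pvmE EA] := hE; have [f2 _] := fV.
have linS : linear_operator mu sqrtA by case: hsqrtA.
have n1_gt0 : 0 < norm1 mu f.
  rewrite lt_neqAle norm1_ge0 andbT eq_sym; apply/eqP => n10.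
  by apply: fn0; exact: norm1_eq0.
have n2_gt0 : 0 < sqnorm mu f.
  rewrite lt_neqAle sqnorm_ge0 andbT eq_sym; apply/eqP => n20.
  by apply: fn0; exact: sqnorm_eq0 f2 n20.
have n2E : n2 ^+ 2 = sqnorm mu f.
  by rewrite /n2 cLnorm2_sqnorm//= sqr_sqrtr ?sqnorm_ge0.
rewrite /energy; case: asboolP => [Sf|_].
  rewrite (cLnorm2_sqr (app_cL2 linS Sf)) n2E; split.
  - exact: (integral_sqr_rc_inverse_le pvmE EA hApos hA hsqrtA hF fV fL1 n1_gt0 Sf).
  - move=> phi phi_convex phi_le; rewrite lee_fin.
    exact: (convex_energy_le pvmE EA hApos hA hsqrtA hF fV fL1 n1_gt0 Sf
      phi_convex phi_le n2_gt0).
  - move=> phi phi_convex phi_le Omega mO Ofin _ f0 _.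
    rewrite inver gt_eqF// lee_fin.
    exact: (convex_energy_support pvmE EA hApos hA hsqrtA hF fV fL1 n1_gt0 Sf
      phi_convex phi_le n2_gt0 mO Ofin f0).
(* Off the domain of [sqrtA] the energy is infinite, and so are all three right-hand sides, the
   divisor [n2 ^+ 2] being positive and finite. *)
have mulry (r : R) : 0 < r -> (r%:E * +oo = +oo)%E by move=> r0; rewrite gt0_muley.
split=> [|phi _ _|phi _ _ Omega _ _ _ _ _]; rewrite mulry ?leey// n2E inver gt_eqF//.
by rewrite gt0_mulye ?leey// lte_fin invr_gt0.
Qed.
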